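(* Let $n,d,k$ be positive integers with $k\le d$ and let $\varepsilon\in(0,1)$. Suppose $\mathcal D$ is a probability distribution over matrices $S\in\mathbb{R}^{m\times n}$ (not depending on the input) and $E$ is an arbitrary estimator (a function of $SA$, $Sb$ and $x$), such that for every $A\in\mathbb{R}^{n\times d}$ and $b\in\mathbb{R}^n$, with constant probability over $S\sim\mathcal D$, every $\tilde x\in\operatorname{argmin}_{x\in\Psi_k}E(SA,Sb,x)$ satisfies $$\|A\tilde x-b\|_2\le(1+\varepsilon)\min_{x\in\Psi_k}\|Ax-b\|_2 .$$ Then $m=\Omega(k\log(d/k)/\varepsilon^2)$.
   Context: $\Psi_k=\{x\in\mathbb{R}^d:\|x\|_0\le k\}$ denotes the set of $k$-sparse vectors. Such a pair $(\mathcal D,E)$ is called an oblivious linear sketch for $k$-sparse $\ell_2$ regression.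
   Formalization: Proved for n ≥ k log(d/k)/ε² (otherwise S = identity is a counterexample); ''constant probability'' means a fixed p > 1/2; success also requires that the argmin is nonempty; the success event is assumed universally measurable in (S,A,b), as holds for Borel E. *)

(* Defs.v *)
From HB Require Import structures.
From mathcomp Require Import all_boot all_order all_algebra.
From mathcomp Require Import all_classical all_reals all_analysis.

Set Implicit Arguments.
Unset Strict Implicit.
Unset Printing Implicit Defensive.

Import Order.TTheory GRing.Theory Num.Theory.
Import numFieldNormedType.Exports.

Local Open Scope classical_set_scope.
Local Open Scope ring_scope.

(* Matrices with their Borel sigma-algebra. *)
Notation borel_mx R m n := (g_sigma_algebraType (@open 'M[R]_(m, n))).

(* MathComp-Analysis norms matrices by the sup norm, hence this definition. *)
Definition l2norm (R : realType) (n : nat) (v : 'cV[R]_n) : R :=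
  Num.sqrt (\sum_(i < n) v i 0 ^+ 2).

Definition l0norm (R : realType) (d : nat) (x : 'cV[R]_d) : nat :=
  #|[set i : 'I_d | x i 0 != 0]%SET|.

Definition sparse (R : realType) (d k : nat) : set 'cV[R]_d :=
  [set x | (l0norm x <= k)%N].

(* The infimum is attained: the k-sparse vectors are a finite union of linear
   subspaces. *)
Definition sparse_opt (R : realType) (n d k : nat)
    (A : 'M[R]_(n, d)) (b : 'cV[R]_n) : R :=
  inf [set l2norm (A *m x - b) | x in sparse k].

Definition argmin_sparse (R : realType) (d k : nat) (f : 'cV[R]_d -> R) :
    set 'cV[R]_d :=
  [set x | sparse k x /\ forall y, sparse k y -> f x <= f y].

(* An estimator, as a function of S A, S b and x. *)
Definition estimator (R : realType) (m d : nat) : Type :=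
  'M[R]_(m, d) -> 'cV[R]_m -> 'cV[R]_d -> R.

(* A minimizer of E is required to exist: if it were not, an estimator without
   minimizers would succeed vacuously, even with m = 0. *)
Definition sketch_succeeds (R : realType) (m n d k : nat) (eps : R)
    (E : estimator R m d)
    (S : 'M[R]_(m, n)) (A : 'M[R]_(n, d)) (b : 'cV[R]_n) : Prop :=
  argmin_sparse k (E (S *m A) (S *m b)) !=set0 /\
  forall x, argmin_sparse k (E (S *m A) (S *m b)) x ->
    l2norm (A *m x - b) <= (1 + eps) * sparse_opt k A b.

Definition universally_measurable (R : realType) (disp : measure_display)
    (T : measurableType disp) (G : set T) : Prop :=
  forall mu : probability T R, exists B C : set T,
    [/\ measurable B, measurable C, B `<=` G, G `<=` C & mu (C `\` B) = 0%E].

(* The event "the sketch succeeds", jointly in (S, (A, b)).  It is universally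
   measurable for every Borel function E, because analytic sets are universally
   measurable.  Some such condition is needed: under the continuum hypothesis
   there are non-measurable E that recover every input with probability 1 from
   m = 2 rows. *)
Definition success_event (R : realType) (m n d k : nat) (eps : R)
    (E : estimator R m d) :
    set (borel_mx R m n * (borel_mx R n d * borel_mx R n 1))%type :=
  [set w | sketch_succeeds k eps E w.1 w.2.1 w.2.2].

(* The sketch does not depend on the input, and for each input it succeeds with
   probability at least p.  For fixed (A, b) the event is only universally
   measurable in S, so its probability is that of a Borel subset. *)
Definition oblivious_linear_sketch (R : realType) (m n d k : nat) (eps p : R)
    (D : probability (borel_mx R m n) R) (E : estimator R m d) : Prop :=
  universally_measurable R (@success_event R m n d k eps E) /\
  forall (A : 'M[R]_(n, d)) (b : 'cV[R]_n),
    exists B : set (borel_mx R m n),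
      [/\ measurable B,
          B `<=` [set S | sketch_succeeds k eps E S A b] &
          (p%:E <= D B)%E].

(* Main.v *)
(* Let b be a standard Gaussian vector, independent of the sketch S.  Averaging
   over b fixes one S that succeeds with probability q > 1/2.  Let phi be the
   reflection equal to the identity on the row space of S and to -1 on its
   kernel.  It preserves both the law of b and the sketch S b, so with positive
   probability a single answer y = A x is (1+eps)-optimal for b and for phi b.
   Since b + phi b = 2 P b with P of rank at most m,
     |y - b|^2 + |y - phi b|^2 = 2 |b|^2 + 2 |y|^2 - 4 <y, P b>,
   which contradicts optimality for small m as soon as the columns of A let
   k-sparse combinations fit a typical b well enough.

   For small eps, the columns are all sign vectors on blocks of log(d/k)
   coordinates, placed on r = k log(d/k) random coordinates out of
   n = c r / eps^2 and scaled so that |y|^2 = n: the best one is closer to b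
   than average by a factor 1 - Theta(sqrt(r/n)) = 1 - Theta(eps), whereas P b
   correlates with a sign vector by O(sqrt(m/n)) times as much.  For eps bounded
   below, finer grids of values in place of signs make the optimum tiny.  When
   k log(d/k) / eps^2 = O(k), the matrix A can be an identity block, with
   optimum 0. *)

(* Two obstacles shape the sign design. A k-sparse x may spend several nonzeros on one block or
   rescale a column, and then y is no sign vector. Extra rows, scaled by a large [M] and with
   constant target [M], make block sums that are off by more than eps too expensive; this is why the
   input has the form [F *m b + b0] with b Gaussian. Moreover, on a fixed set of r coordinates a
   sketch of rank r could read everything, and r is only of order eps^2 times the claimed rank.
   Hence the position is a uniform shift t, averaged together with b when S is fixed. The reflection
   has to be adapted to an arbitrary S, so the Gaussian law must be invariant in every direction
   that S may impose. Invariance is proved for sign changes and Givens rotations, and an LQ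
   reduction reaches the needed reflection from these. All tail bounds are Markov inequalities on
   second and fourth moments, which is enough because only constant failure probabilities occur; the
   numerical constants are accordingly crude. The bound k ln(d/k) / eps^2 <= n is the room in which
   the hard instance is placed; the identity, a sketch with n rows, shows that it cannot be
   dropped. *)
Require Import Defs.
From HB Require Import structures.
From mathcomp Require Import all_boot all_order all_algebra.
From mathcomp Require Import all_classical all_reals all_analysis.
From mathcomp Require Import measurable_realfun ring lra zify.
Set Implicit Arguments.
Unset Strict Implicit.
Unset Printing Implicit Defensive.
Import Order.TTheory GRing.Theory Num.Theory.
Import numFieldNormedType.Exports.
Local Open Scope classical_set_scope.
Local Open Scope ring_scope.

(** * Measurability of matrix-valued functions *)

Section MeasurableMatrix.
Context {R : realType}.

Lemma measurable_mx_entry m n (i : 'I_m) (j : 'I_n) :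
  measurable_fun setT (fun M : borel_mx R m n => (M : 'M[R]_(m, n)) i j : R).
Proof.
apply: (measurability _ (measurable_realfun.RGenOpens.measurableE R)) => _ [_ [a [b ->]] <-].
rewrite setTI; apply: sub_sigma_algebra.
have /continuousP : continuous (fun M : 'M[R]_(m, n) => M i j).
  by move=> M; exact: coord_continuous.
by apply; exact: interval_open.
Qed.

(** Every open set of matrices is a countable union of boxes with rational centre and radius, and a
    box is a finite intersection of conditions on single entries. *)
Lemma measurable_fun_mx d (T : measurableType d) m n (f : T -> borel_mx R m n) :
  (forall i j, measurable_fun setT (fun w => (f w : 'M[R]_(m, n)) i j : R)) ->
  measurable_fun setT f.
Proof.
move=> mf; apply: (@measurability _ _ T (borel_mx R m n) setT f (@open 'M[R]_(m, n)) erefl) => _ [V oV <-]; rewrite setTI.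
pose box (q : 'M[rat]_(m, n) * rat) : set 'M[R]_(m, n) :=
  [set M | forall i j, `|M i j - ratr (q.1 i j)| < ratr q.2].
have mbox q : measurable (f @^-1` box q).
  have -> : f @^-1` box q =
     \bigcap_(i in [set: 'I_m]) \bigcap_(j in [set: 'I_n])
       ((fun w => `|(f w : 'M[R]_(m, n)) i j - ratr (q.1 i j)|)
          @^-1` `]-oo, ratr q.2[).
    apply/seteqP; split => [w bw i _ j _|w bw i j] /=.
      by rewrite in_itv /= ; exact: bw.
    by have := bw i I j I; rewrite /= in_itv.
  apply: fin_bigcap_measurable => // i _; apply: fin_bigcap_measurable => // j _.
  rewrite -[X in measurable X]setTI.
  apply: measurableT_comp => //=.
  exact: measurable_funB.
have -> : V = \bigcup_(q in [set q | box q `<=` V]) box q.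
  apply/seteqP; split => [M VM|M [q /= + ]]; last exact.
  have /nbhs_ballP[e /= e0 MeV] : nbhs M V by exact: open_nbhs_nbhs.
  have [r /andP[r0 re]] : exists r : rat, 0 < (ratr r : R) < e / 2.
    have [r] := rat_in_itvoo (divr_gt0 e0 (ltr0Sn _ 1)).
    by rewrite in_itv /=; exists r.
  have hq i j : {q : rat | `|M i j - ratr q| < ratr r}.
    apply: cid; have [] := @rat_in_itvoo R (M i j - ratr r) (M i j + ratr r).
      by lra.
    move=> q; rewrite in_itv /= => /andP[q1 q2]; exists q.
    by rewrite ltr_norml; apply/andP; split; lra.
  exists (\matrix_(i, j) sval (hq i j), r) => /=.
    move=> N /= bN; apply: MeV; split=> // i j.
    have := bN i j; rewrite mxE /ball /=.
    case: (hq i j) => q /= hM hN.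
    have := ler_distD (ratr q) (M i j) (N i j).
    rewrite [`|ratr q - N i j|]distrC; lra.
  by move=> i j /=; rewrite mxE; case: (hq i j).
rewrite preimage_bigcup bigcup_mkcond; apply: countable_bigcupT_measurable.
  exact: countableP.
by move=> q; case: ifP.
Qed.

End MeasurableMatrix.

(** * The standard Gaussian on the line and its square *)

Section GaussianLine.
Context {R : realType}.
Local Notation leb := (@lebesgue_measure R).
Local Notation gauss := (normal_prob (0 : R) 1).
Local Notation phi := (normal_pdf (0 : R) 1).

Lemma measurable_EFin_normal_pdf (m s : R) :
  measurable_fun setT (fun x => (normal_pdf m s x)%:E).
Proof. by apply/measurable_EFinP; exact: measurable_normal_pdf. Qed.

(** The Radon-Nikodym derivative of the law and [normal_pdf] have the same integral over every
    measurable set, hence agree almost everywhere. *)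
Lemma ge0_integral_normal_prob (m s : R) (f : R -> \bar R) :
  measurable_fun setT f -> (forall x, 0 <= f x)%E ->
  (\int[normal_prob m s]_x f x = \int[leb]_x (f x * (normal_pdf m s x)%:E))%E.
Proof.
move=> mf f0.
have dom : normal_prob m s `<< leb := normal_prob_dominates m s.
rewrite -(Radon_Nikodym_SigmaFinite.change_of_variables dom)//.
apply: ae_eq_integral => //.
- apply: emeasurable_funM => //; apply: (measurable_int leb).
  exact: Radon_Nikodym_SigmaFinite.f_integrable.
- by apply: emeasurable_funM => //; exact: measurable_EFin_normal_pdf.
apply: ae_eqe_mul2l; apply: integral_ae_eq => //.
- exact: Radon_Nikodym_SigmaFinite.f_integrable.
- exact: measurable_EFin_normal_pdf.
- by move=> E _ mE; rewrite -Radon_Nikodym_SigmaFinite.f_integral.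
Qed.

(** Uniqueness of Lebesgue measure: the translated measure gives half-open intervals their
    length. *)
Lemma lebesgue_measure_addr (t : R) (A : set R) : measurable A ->
  leb [set x | A (x + t)] = leb A.
Proof.
move=> mA; have mt : measurable_fun setT (fun x : measurableTypeR R => x + t).
  exact: measurable_funD.
transitivity (pushforward leb (fun x : R => x + t : measurableTypeR R) A) => //.
apply/esym; apply: lebesgue_measure_unique => //= _ [[a b]] _ <-.
rewrite /pushforward (_ : _ @^-1` _ = `]a - t, b - t]%classic); last first.
  by apply/seteqP; split => x /=; rewrite !in_itv /= ltrBlDr lerBrDr.
by rewrite !lebesgue_measure_itv/= !lte_fin ltrD2r -!EFinB opprB addrA subrK.
Qed.

Lemma ge0_integral_lebesgue_addr (t : R) (f : R -> \bar R) :
  measurable_fun setT f -> (forall x, 0 <= f x)%E ->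
  (\int[leb]_x f (x + t)%R = \int[leb]_x f x)%E.
Proof.
move=> mf f0.
have mt : measurable_fun setT (fun x : measurableTypeR R => x + t : measurableTypeR R).
  exact: measurable_funD.
rewrite -[LHS](ge0_integral_pushforward mt leb measurableT)//.
by apply: eq_measure_integral => A mA _; exact: lebesgue_measure_addr.
Qed.


Lemma lebesgue_tonelli1 (g : R * R -> \bar R) :
  measurable_fun setT g -> (forall z, 0 <= g z)%E ->
  (\int[leb \x leb]_z g z = \int[leb]_x \int[leb]_y g (x, y))%E.
Proof.
by move=> mg; exact: (@fubini_tonelli1 _ _ (measurableTypeR R) (measurableTypeR R)).
Qed.

Lemma lebesgue_tonelli2 (g : R * R -> \bar R) :
  measurable_fun setT g -> (forall z, 0 <= g z)%E ->
  (\int[leb \x leb]_z g z = \int[leb]_y \int[leb]_x g (x, y))%E.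
Proof.
by move=> mg; exact: (@fubini_tonelli2 _ _ (measurableTypeR R) (measurableTypeR R)).
Qed.

Lemma measurable_shear1 (t : R) :
  measurable_fun setT (fun z : R * R => (z.1 + t * z.2, z.2)).
Proof.
apply/measurable_fun_pairP; split; last exact: measurable_snd.
by apply: measurable_funD => //; exact: measurable_funM.
Qed.

Lemma measurable_shear2 (t : R) :
  measurable_fun setT (fun z : R * R => (z.1, z.2 + t * z.1)).
Proof.
apply/measurable_fun_pairP; split; first exact: measurable_fst.
by apply: measurable_funD => //; exact: measurable_funM.
Qed.

Lemma integral_shear1 (t : R) (g : R * R -> \bar R) :
  measurable_fun setT g -> (forall z, 0 <= g z)%E ->
  (\int[leb \x leb]_z g (z.1 + t * z.2, z.2)%R = \int[leb \x leb]_z g z)%E.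
Proof.
move=> mg g0; rewrite [RHS]lebesgue_tonelli2// lebesgue_tonelli2//=; last first.
  by apply: measurableT_comp => //; exact: measurable_shear1.
apply: eq_integral => y _.
apply: (@ge0_integral_lebesgue_addr (t * y) (fun x => g (x, y))) => //.
exact: measurableT_comp.
Qed.

Lemma integral_shear2 (t : R) (g : R * R -> \bar R) :
  measurable_fun setT g -> (forall z, 0 <= g z)%E ->
  (\int[leb \x leb]_z g (z.1, z.2 + t * z.1)%R = \int[leb \x leb]_z g z)%E.
Proof.
move=> mg g0; rewrite [RHS]lebesgue_tonelli1// lebesgue_tonelli1//=; last first.
  by apply: measurableT_comp => //; exact: measurable_shear2.
apply: eq_integral => x _.
apply: (@ge0_integral_lebesgue_addr (t * x) (fun y => g (x, y))) => //.
exact: measurableT_comp.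
Qed.

Definition rotation (c s : R) (z : R * R) : R * R :=
  (c * z.1 - s * z.2, s * z.1 + c * z.2).

Lemma measurable_rotation (c s : R) : measurable_fun setT (rotation c s).
Proof.
by apply/measurable_fun_pairP; split => /=;
  [apply: measurable_funB|apply: measurable_funD] => //; exact: measurable_funM.
Qed.

(* The rotation is a product of three shears, each of which is a translation
   in one variable when the other one is fixed. *)
Lemma integral_rotation (c s : R) (g : R * R -> \bar R) :
  c ^+ 2 + s ^+ 2 = 1 -> 0 <= c ->
  measurable_fun setT g -> (forall z, 0 <= g z)%E ->
  (\int[leb \x leb]_z g (rotation c s z) = \int[leb \x leb]_z g z)%E.
Proof.
(* [t] is the tangent of the half angle; [0 <= c] keeps its denominator away from 0. *)
move=> cs c0 mg g0; pose t := s / (1 + c).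
have c1 : 1 + c != 0 by rewrite gt_eqF// ltr_pwDl.
have ts : s * t = 1 - c.
  rewrite /t; apply: (mulIf c1); rewrite mulrA divfK//.
  have -> : s * s = 1 - c ^+ 2 by rewrite -cs; ring.
  ring.
have tc : t * (1 + c) = s by rewrite /t divfK.
rewrite -(@integral_shear1 (- t) g)//.
have mg1 : measurable_fun setT (fun z : R * R => g (z.1 + - t * z.2, z.2)).
  by apply: measurableT_comp => //; exact: measurable_shear1.
rewrite -(@integral_shear2 s (fun z => g (z.1 + - t * z.2, z.2)))//=.
rewrite -(@integral_shear1 (- t)
  (fun z => g (z.1 + - t * (z.2 + s * z.1), z.2 + s * z.1)))//=; last first.
  exact: (measurableT_comp mg1 (measurable_shear2 s)).
apply: eq_integral => -[x y] _ /=; congr (g (_, _)).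
  have -> : c * x - s * y = (1 - (s * t)) * x - t * (1 + (1 - s * t)) * y.
    by rewrite ts subKr tc.
  ring.
have -> /= : c = 1 - s * t by rewrite ts subKr.
ring.
Qed.

Lemma gauss_indic (B : set R) : measurable B ->
  gauss B = (\int[leb]_x ((\1_B x)%:E * (phi x)%:E))%E.
Proof.
move=> mB; rewrite -[LHS](_ : \int[gauss]_x (\1_B x)%:E = _)%E.
  apply: ge0_integral_normal_prob; last by move=> x; rewrite lee_fin.
  exact/measurable_EFinP/measurable_indic.
by rewrite integral_indic// setIT.
Qed.

Lemma gauss_prodE (A : set (R * R)) : measurable A ->
  (gauss \x gauss)%E A =
  (\int[leb \x leb]_z ((\1_A z)%:E * (phi z.1 * phi z.2)%R%:E))%E.
Proof.
move=> mA; rewrite lebesgue_tonelli1//=; last 2 first.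
- apply: emeasurable_funM; first exact/measurable_EFinP/measurable_indic.
  apply/measurable_EFinP; apply: measurable_funM.
    by apply: measurableT_comp => //; exact: measurable_normal_pdf.
  by apply: measurableT_comp => //; exact: measurable_normal_pdf.
- by move=> z; rewrite mule_ge0// lee_fin ?mulr_ge0// normal_pdf_ge0.
transitivity (\int[leb]_x (gauss (xsection A x) * (phi x)%:E))%E.
  apply: (@ge0_integral_normal_prob 0 1 (fun x => gauss (xsection A x))) => //.
  exact: measurable_fun_xsection.
apply: eq_integral => x _; rewrite /=.
rewrite gauss_indic; last exact: measurable_xsection.
rewrite -ge0_integralZr//=; last 3 first.
- apply: emeasurable_funM; last exact: measurable_EFin_normal_pdf.
  by apply/measurable_EFinP/measurable_indic; exact: measurable_xsection.
- by move=> y _; rewrite mule_ge0// lee_fin ?normal_pdf_ge0.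
- by rewrite lee_fin normal_pdf_ge0.
apply: eq_integral => y _; rewrite -!EFinM; congr EFin.
rewrite (mulrC (phi x)) mulrA; congr (_ * _ * _).
by rewrite !indicE mem_xsection.
Qed.

(** The joint density depends on [z.1 ^+ 2 + z.2 ^+ 2] alone. *)
Lemma normal_pdf_rotation (c s : R) (z : R * R) : c ^+ 2 + s ^+ 2 = 1 ->
  phi (rotation c s z).1 * phi (rotation c s z).2 = phi z.1 * phi z.2.
Proof.
move=> cs; rewrite !normal_pdfE ?oner_neq0//= /normal_fun.
rewrite mulrACA -expRD [RHS]mulrACA -expRD; congr (_ * expR _).
rewrite !subr0 -!mulrDl; congr (_ / _).
rewrite -!opprD; congr (- _).
have -> : z.1 ^+ 2 + z.2 ^+ 2 = (c ^+ 2 + s ^+ 2) * (z.1 ^+ 2 + z.2 ^+ 2).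
  by rewrite cs mul1r.
ring.
Qed.

Lemma gauss_prod_rotation (c s : R) (A : set (R * R)) :
  c ^+ 2 + s ^+ 2 = 1 -> 0 <= c -> measurable A ->
  ((gauss \x gauss) (rotation c s @^-1` A) = (gauss \x gauss) A)%E.
Proof.
move=> cs c0 mA; rewrite !gauss_prodE//; last first.
  by rewrite -[X in measurable X]setTI; exact: measurable_rotation.
have mg : measurable_fun setT
    (fun z : R * R => (\1_A z)%:E * (phi z.1 * phi z.2)%R%:E)%E.
  apply: emeasurable_funM; first exact/measurable_EFinP/measurable_indic.
  apply/measurable_EFinP; apply: measurable_funM.
    by apply: measurableT_comp => //; exact: measurable_normal_pdf.
  by apply: measurableT_comp => //; exact: measurable_normal_pdf.
rewrite -(integral_rotation cs c0 mg); last first.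
  by move=> z; rewrite mule_ge0// lee_fin ?mulr_ge0// normal_pdf_ge0.
by apply: eq_integral => z _; rewrite normal_pdf_rotation.
Qed.

Lemma ge0_integral_lebesgue_oppr (f : R -> \bar R) :
  measurable_fun setT f -> (forall x, 0 <= f x)%E ->
  (\int[leb]_x f (- x)%R = \int[leb]_x f x)%E.
Proof.
move=> mf f0.
have mN : measurable_fun setT (-%R : measurableTypeR R -> measurableTypeR R).
  exact: oppr_measurable.
rewrite -[LHS](ge0_integral_pushforward mN leb measurableT)//.
by apply: eq_measure_integral => A mA _; exact: lebesgue_measureN.
Qed.

Lemma gauss_oppr (A : set R) : measurable A -> gauss [set x | A (- x)] = gauss A.
Proof.
move=> mA; have mNA : measurable [set x : R | A (- x)].
  by rewrite -[X in measurable X]setTI; exact: oppr_measurable.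
rewrite !gauss_indic// -[RHS]ge0_integral_lebesgue_oppr; last 2 first.
- apply: emeasurable_funM; last exact: measurable_EFin_normal_pdf.
  exact/measurable_EFinP/measurable_indic.
- by move=> x; rewrite mule_ge0// lee_fin ?normal_pdf_ge0.
apply: eq_integral => x _; congr (_ * _)%E.
by rewrite !normal_pdfE ?oner_neq0// /normal_fun !subr0 sqrrN.
Qed.

End GaussianLine.

(** * Small balls and moments of the Gaussian *)

Section GaussianMoments.
Context {R : realType}.
Local Notation leb := (@lebesgue_measure R).
Local Notation gauss := (normal_prob (0 : R) 1).

Lemma normal_peak1_le : normal_peak (1 : R) <= 2^-1.
Proof.
rewrite /normal_peak lef_pV2 ?posrE// ?sqrtr_gt0; last first.
  by rewrite expr1n mul1r mulrn_wgt0// pi_gt0.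
rewrite -[2 in leLHS](@ger0_norm R)// -sqrtr_sqr ler_sqrt.
  by have := pi_ge2 R; rewrite expr1n mul1r; lra.
by rewrite expr1n mul1r mulrn_wge0// pi_ge0.
Qed.

(** The density is at most 1/2, because pi >= 2, and the interval has length 2a. *)
Lemma gauss_small_ball (a : R) : 0 <= a ->
  (gauss [set x | (`|x| < a)%R] <= a%:E)%E.
Proof.
move=> a0; have -> : [set x : R | `|x| < a] = `]- a, a[%classic.
  by apply/seteqP; split => x /=; rewrite in_itv /= ltr_norml.
rewrite gauss_indic//.
apply: (@le_trans _ _ (\int[leb]_x ((2^-1 : R)%:E * (\1_`](- a)%R, a[ x)%:E))%E).
  apply: ge0_le_integral => //.
  - by move=> x _; rewrite mule_ge0// lee_fin ?normal_pdf_ge0.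
  - apply: emeasurable_funM; last exact: measurable_EFin_normal_pdf.
    exact/measurable_EFinP/measurable_indic.
  - apply: emeasurable_funM => //.
    exact/measurable_EFinP/measurable_indic.
  move=> x _; rewrite muleC -!EFinM lee_fin ler_wpM2r//.
  by rewrite (le_trans (normal_pdf_ub _ _ _)) ?oner_neq0// normal_peak1_le.
rewrite ge0_integralZl//; last exact/measurable_EFinP/measurable_indic.
rewrite integral_indic// setIT.
have vol : (leb `](- a)%R, a[%classic <= (2 * a)%:E)%E.
  rewrite lebesgue_measure_itv /= lte_fin.
  by case: ifP => _; rewrite lee_fin; lra.
by apply: (le_trans (lee_wpmul2l _ vol)) => //; rewrite -EFinM lee_fin; lra.
Qed.

(* Compares x^4 times the density with the density of variance 4. *)
Lemma gauss_fourth_moment : (\int[gauss]_x (x ^+ 4)%:E <= 64%:E)%E.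
Proof.
rewrite ge0_integral_normal_prob//; last 2 first.
- by apply/measurable_EFinP; exact: measurable_funX.
- by move=> x; rewrite lee_fin exprn_even_ge0.
apply: (@le_trans _ _ (\int[leb]_x ((64 : R)%:E * (normal_pdf 0 2 x)%:E))%E);
  last first.
  rewrite ge0_integralZl//=; last 2 first.
  - exact: measurable_EFin_normal_pdf.
  - by move=> x _; rewrite lee_fin normal_pdf_ge0.
  by rewrite integral_normal_pdf mule1.
apply: ge0_le_integral => //.
- by move=> x _; rewrite mule_ge0// lee_fin ?normal_pdf_ge0// exprn_even_ge0.
- apply: emeasurable_funM; last exact: measurable_EFin_normal_pdf.
  by apply/measurable_EFinP; exact: measurable_funX.
- by apply: emeasurable_funM => //; exact: measurable_EFin_normal_pdf.
move=> x _; rewrite -!EFinM lee_fin !normal_pdfE ?oner_neq0 ?pnatr_eq0//=.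
have -> : normal_peak 2 = 2^-1 * normal_peak 1 :> R.
  rewrite /normal_peak expr1n mul1r -invfM; congr _^-1.
  rewrite -mulrnAr sqrtrM ?exprn_even_ge0// sqrtr_sqr ger0_norm//.
(* [expR (- u) ^+ 2] is the quotient of the two exponentials. Since [u * expR (- u) <= 1], the
   factor x^4 = (256/9) u^2 costs at most 256/9 <= 32, and the quotient 2 of the peaks makes this
   64. *)
pose u := 3 * x ^+ 2 / 16.
have u0 : 0 <= u by rewrite /u; have := sqr_ge0 x; lra.
have -> : normal_fun 0 1 x = normal_fun 0 2 x * expR (- u) ^+ 2.
  by rewrite /normal_fun -expRM_natl -expRD; congr expR; rewrite /u; field.
have e0 := expR_gt0 (- u).
have ue : u * expR (- u) <= 1.
  rewrite expRN ler_pdivrMr ?expR_gt0// mul1r.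
  by have := expR_ge1Dx u; lra.
have -> : x ^+ 4 = 256 / 9 * u ^+ 2 by rewrite /u; field.
have : (u * expR (- u)) ^+ 2 <= 1.
  by rewrite expr_le1// mulr_ge0// ltW.
rewrite exprMn => h.
have nn : 0 <= normal_peak 1 * normal_fun 0 2 x.
  by rewrite mulr_ge0 ?normal_peak_ge0 ?normal_fun_ge0.
set N := normal_fun 0 2 x in nn *; set p1 := normal_peak 1 in nn *.
have -> : 256 / 9 * u ^+ 2 * (p1 * (N * expR (- u) ^+ 2)) =
          256 / 9 * (u ^+ 2 * expR (- u) ^+ 2) * (p1 * N) by ring.
have -> : 64 * (2^-1 * p1 * N) = 32 * (p1 * N) by field.
by rewrite ler_wpM2r//; lra.
Qed.

(** Any absolute constant serves; x^2 <= 1 + x^4 reduces to the fourth moment and gives the 65 of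
    the row bounds. *)
Lemma gauss_second_moment : (\int[gauss]_x (x ^+ 2)%:E <= 65%:E)%E.
Proof.
apply: (@le_trans _ _ (\int[gauss]_x (1 + (x ^+ 4)%:E))%E).
  apply: ge0_le_integral => //.
  - by move=> x _; rewrite lee_fin sqr_ge0.
  - by apply/measurable_EFinP; exact: measurable_funX.
  - apply: emeasurable_funD => //; apply/measurable_EFinP; exact: measurable_funX.
  move=> x _; rewrite -EFinD lee_fin.
  by have := sqr_ge0 (x ^+ 2 - 1); have := sqr_ge0 x; nra.
rewrite ge0_integralD//; last 2 first.
- by move=> x _; rewrite lee_fin exprn_even_ge0.
- by apply/measurable_EFinP; exact: measurable_funX.
rewrite (_ : \int[gauss]_x 1 = 1)%E; last first.
  by rewrite integral_cst// mul1e; exact: probability_setT.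
have -> : 65%:E = (1 + 64%:E :> \bar R)%E by rewrite -EFinD; congr EFin; ring.
by rewrite leeD2l// gauss_fourth_moment.
Qed.

End GaussianMoments.

(** * Standard Gaussian vectors and their isometries *)

Lemma ge0_integral_preserving d (T : measurableType d) (R : realType)
    (mu : {measure set T -> \bar R}) (f : T -> T) (g : T -> \bar R) :
  measurable_fun setT f -> (forall A, measurable A -> mu (f @^-1` A) = mu A) ->
  measurable_fun setT g -> (forall x, 0 <= g x)%E ->
  (\int[mu]_x g (f x) = \int[mu]_x g x)%E.
Proof.
move=> mf fmu mg g0.
rewrite -[LHS](ge0_integral_pushforward mf mu measurableT)//.
by apply: eq_measure_integral => A mA _; exact: fmu.
Qed.

Section GaussianVector.
Context {R : realType}.
Local Notation gauss := (normal_prob (0 : R) 1).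

Lemma measurable_mulmxr d (T : measurableType d) m n p (A : 'M[R]_(m, n))
    (f : T -> borel_mx R n p) : measurable_fun setT f ->
  measurable_fun setT (fun w => A *m (f w : 'M[R]_(n, p)) : borel_mx R m p).
Proof.
move=> mf; apply: measurable_fun_mx => i j.
under eq_fun do rewrite mxE.
apply: measurable_sum => k; apply: measurable_funM => //.
exact: measurableT_comp (measurable_mx_entry k j) mf.
Qed.

Definition cons_vec n (w : measurableTypeR R * borel_mx R n 1) :
    borel_mx R n.+1 1 :=
  col_mx (w.1)%:M (w.2 : 'cV[R]_n) : 'cV[R]_(1 + n).

Lemma cons_vec0 n (w : measurableTypeR R * borel_mx R n 1) :
  (cons_vec w : 'cV[R]_n.+1) 0 0 = w.1.
Proof.
have -> : 0 = lshift n 0 :> 'I_(1 + n) by apply: val_inj.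
exact: etrans (col_mxEu (w.1)%:M (w.2 : 'cV[R]_n) 0 0) (mxE _ _ _ _).
Qed.

Lemma cons_vecS n (w : measurableTypeR R * borel_mx R n 1) (k : 'I_n) :
  (cons_vec w : 'cV[R]_n.+1) (lift 0 k) 0 = (w.2 : 'cV[R]_n) k 0.
Proof.
have -> : lift 0 k = rshift 1 k by apply: val_inj.
exact: (col_mxEd (w.1)%:M (w.2 : 'cV[R]_n) k 0).
Qed.

Lemma measurable_cons_vec n : measurable_fun setT (@cons_vec n).
Proof.
apply: measurable_fun_mx => i j; rewrite (ord1 j).
have [k ->|->] := unliftP 0 i.
  under eq_fun do rewrite cons_vecS.
  exact: measurableT_comp (measurable_mx_entry k 0) measurable_snd.
under eq_fun do rewrite cons_vec0.
exact: measurable_fst.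
Qed.

HB.instance Definition _ n := isMeasurableFun.Build _ _ _ _ (@cons_vec n)
  (@measurable_cons_vec n).

(** Built one coordinate at a time, starting from the point mass on the empty vector, so that the
    first coordinates can be integrated separately and a rotation of the first two becomes a
    statement about [gauss \x gauss]. *)
Fixpoint gaussvec n : probability (borel_mx R n 1) R :=
  if n is n'.+1 then distribution (gauss \x gaussvec n')%E (@cons_vec n')
  else \d_((0 : 'cV[R]_0) : borel_mx R 0 1).

Lemma measurable_gaussvec_section n (X : set (borel_mx R n.+1 1)) (a : R) :
  measurable X -> measurable [set v | X (@cons_vec n (a, v))].
Proof.
move=> mX; rewrite -[X in measurable X]setTI.
exact: (measurableT_comp (@measurable_cons_vec n)).
Qed.

Lemma gaussvec_consE n (X : set (borel_mx R n.+1 1)) :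
  gaussvec n.+1 X =
  (\int[gauss]_a gaussvec n [set v | X (cons_vec (a, v))])%E.
Proof.
rewrite /= /distribution /pushforward /= /product_measure1.
apply: eq_integral => a _ /=; congr (gaussvec n _).
by apply/seteqP; split => v; rewrite /xsection /= inE.
Qed.

(** Invariance of the law is carried along instead of being deduced from orthogonality: it is
    checked on sign changes and Givens rotations and passes to products and transposes, which yields
    all the matrices used. *)
Definition gauss_isometry n (U : 'M[R]_n) : Prop :=
  U^T *m U = 1%:M /\ forall X : set (borel_mx R n 1), measurable X ->
    gaussvec n [set v | X (U *m (v : 'cV[R]_n))] = gaussvec n X.

Lemma measurable_mulmx_preimage m n (U : 'M[R]_(m, n)) (X : set (borel_mx R m 1)) :
  measurable X ->
  measurable ([set v | X (U *m (v : 'cV[R]_n))] : set (borel_mx R n 1)).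
Proof.
move=> mX; rewrite -[X in measurable X]setTI.
exact: (measurable_mulmxr U (@measurable_id _ _ setT)).
Qed.

Lemma gauss_isometry1 n : gauss_isometry (1%:M : 'M[R]_n).
Proof.
split; first by rewrite trmx1 mulmx1.
by move=> X mX; under eq_fun do rewrite mul1mx.
Qed.

Lemma gauss_isometryM n (U V : 'M[R]_n) :
  gauss_isometry U -> gauss_isometry V -> gauss_isometry (U *m V).
Proof.
move=> [UU gU] [VV gV]; split.
  by rewrite trmx_mul mulmxA -(mulmxA V^T) UU mulmx1.
move=> X mX; rewrite -[RHS]gU// -[RHS]gV; last exact: measurable_mulmx_preimage.
by congr (gaussvec n _); apply/seteqP; split=> v /=; rewrite mulmxA.
Qed.

Lemma gauss_isometry_tr n (U : 'M[R]_n) : gauss_isometry U -> gauss_isometry U^T.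
Proof.
move=> [UU gU]; split; first by rewrite trmxK; exact: mulmx1C.
move=> X mX; rewrite -[LHS]gU; last exact: measurable_mulmx_preimage.
congr (gaussvec n _); apply/seteqP; split=> v /=;
by rewrite mulmxA UU mul1mx.
Qed.

Lemma measurable_gaussvec_cons n (X : set (borel_mx R n.+1 1)) : measurable X ->
  measurable_fun setT (fun a : R => gaussvec n [set v | X (cons_vec (a, v))]).
Proof.
move=> mX; have mX' : measurable (@cons_vec n @^-1` X).
  by rewrite -[X in measurable X]setTI; exact: measurable_cons_vec.
rewrite (_ : (fun _ => _) = gaussvec n \o xsection (@cons_vec n @^-1` X)).
  exact: measurable_fun_xsection.
apply/funext => a /=; congr (gaussvec n _).
by apply/seteqP; split => v; rewrite /xsection /= inE.
Qed.

Lemma gauss_isometry_block n (e : R) (U : 'M[R]_n) : e ^+ 2 = 1 ->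
  gauss_isometry U ->
  gauss_isometry (block_mx e%:M 0 0 U : 'M[R]_(1 + n)).
Proof.
move=> e1 [UU gU]; split.
  rewrite tr_block_mx mulmx_block !trmx0 !mulmx0 !mul0mx !addr0 add0r UU.
  by rewrite tr_scalar_mx -scalar_mxM -expr2 e1 -scalar_mx_block.
move=> X mX.
rewrite !gaussvec_consE.
transitivity (\int[gauss]_a gaussvec n [set v | X (cons_vec ((e * a)%R, v))])%E.
  apply: eq_integral => a _.
  rewrite -[RHS]gU; last exact: measurable_gaussvec_section.
  congr (gaussvec n _); apply/seteqP; split => v /=;
  by rewrite /cons_vec mul_block_col/= !mul0mx addr0 add0r -scalar_mxM.
have [->|->] : e = 1 \/ e = - 1.
  by have /eqP := e1; rewrite sqrf_eq1 => /orP[] /eqP; [left|right].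
- by apply: eq_integral => a _; rewrite mul1r.
under eq_integral do rewrite mulN1r.
apply: (@ge0_integral_preserving _ _ _ gauss -%R
  (fun a => gaussvec n [set v | X (cons_vec (a, v))])) => //.
- by move=> A mA; exact: gauss_oppr.
- exact: measurable_gaussvec_cons.
Qed.

Definition givens n (c s : R) : 'M[R]_(1 + (1 + n)) :=
  block_mx c%:M (row_mx (- s)%:M 0) (col_mx s%:M 0) (block_mx c%:M 0 0 1%:M).

Lemma mulmx_givens n (c s a b : R) (v : 'cV[R]_n) :
  givens n c s *m (cons_vec (a, cons_vec (b, v)) : 'cV[R]_n.+2) =
  cons_vec ((c * a - s * b)%R, cons_vec ((s * a + c * b)%R, v)).
Proof.
rewrite /givens /cons_vec /= mul_block_col mul_row_col mul_col_mx.
rewrite mul_block_col !mul0mx !mul1mx !addr0 add0r add_col_mx add0r.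
by rewrite -!scalar_mxM -!raddfD/= mulNr.
Qed.

Lemma cons_vec_surj n (v : 'cV[R]_n.+1) :
  exists a (w : 'cV[R]_n), v = cons_vec (a, w).
Proof.
exists (v 0 0), (\col_k v (lift 0 k) 0); apply/colP => i.
by have [k ->|->] := unliftP 0 i; rewrite ?cons_vecS ?cons_vec0 ?mxE.
Qed.

Lemma gauss_isometry_givens n (c s : R) : c ^+ 2 + s ^+ 2 = 1 -> 0 <= c ->
  gauss_isometry (givens n c s).
Proof.
move=> cs c0; split.
  have -> : (givens n c s)^T = givens n c (- s).
    rewrite /givens tr_block_mx tr_row_mx tr_col_mx tr_block_mx !tr_scalar_mx.
    by rewrite !trmx0 opprK.
  suff h (v : 'cV[R]_n.+2) : givens n c (- s) *m (givens n c s *m v) = v.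
    apply/matrixP => i j; have := h (delta_mx j 0).
    by rewrite mulmxA -colE => /colP/(_ i); rewrite !mxE eqxx andbT => ->.
  have [a [w ->]] := cons_vec_surj v; have [b [w' ->]] := cons_vec_surj w.
  rewrite !mulmx_givens; congr (cons_vec (_, cons_vec (_, _))).
    by transitivity ((c ^+ 2 + s ^+ 2) * a); [ring|rewrite cs mul1r].
  by transitivity ((c ^+ 2 + s ^+ 2) * b); [ring|rewrite cs mul1r].
move=> X mX.
(* [h z] is the mass of the section of X over the first two coordinates z; the claim becomes the
   invariance of its planar integral under [rotation c s]. *)
pose h (z : R * R) := gaussvec n [set v | X (cons_vec (z.1, cons_vec (z.2, v)))].
have mpair : measurable_fun setT
    (fun zw : (R * R) * borel_mx R n 1 => @cons_vec n.+1 (zw.1.1, @cons_vec n (zw.1.2, zw.2))).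
  apply: (measurableT_comp (@measurable_cons_vec n.+1)).
  apply/measurable_fun_pairP; split => /=.
    exact: (measurableT_comp measurable_fst measurable_fst).
  apply: (measurableT_comp (@measurable_cons_vec n)).
  apply/measurable_fun_pairP; split => /=; last exact: measurable_snd.
  exact: (measurableT_comp measurable_snd measurable_fst).
have mh : measurable_fun setT h.
  pose Y := (fun zw : (R * R) * borel_mx R n 1 =>
    @cons_vec n.+1 (zw.1.1, @cons_vec n (zw.1.2, zw.2))) @^-1` X.
  have mY : measurable Y by rewrite -[X in measurable X]setTI; exact: mpair.
  rewrite (_ : h = gaussvec n \o xsection Y).
    exact: measurable_fun_xsection.
  apply/funext => z /=; congr (gaussvec n _).
  by apply/seteqP; split => v; rewrite /xsection /= inE.
have h0 z : (0 <= h z)%E by [].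
have intE (k : R * R -> R * R) : measurable_fun setT k ->
    (\int[gauss]_a \int[gauss]_b h (k (a, b)) =
     \int[gauss \x gauss]_z h (k z))%E.
  by move=> mk; rewrite fubini_tonelli1//; exact: measurableT_comp.
transitivity (\int[gauss]_a \int[gauss]_b h (rotation c s (a, b)))%E.
  rewrite gaussvec_consE; apply: eq_integral => a _.
  rewrite gaussvec_consE; apply: eq_integral => b _.
  congr (gaussvec n _); apply/seteqP; split => v;
  by rewrite /= mulmx_givens.
transitivity (\int[gauss]_a \int[gauss]_b h (a, b))%E; last first.
  rewrite gaussvec_consE; apply: eq_integral => a _.
  by rewrite gaussvec_consE.
rewrite (intE _ (measurable_rotation c s)) (intE id)//.
apply: (@ge0_integral_preserving _ _ _ (gauss \x gauss)%E (rotation c s) h) => //.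
  exact: measurable_rotation.
by move=> A mA; exact: gauss_prod_rotation.
Qed.

End GaussianVector.

(** * Triangularization by Gaussian isometries *)

Section Reflection.
Context {R : realType}.

Lemma mul_row_givens n (c s a b : R) :
  row_mx a%:M (row_mx b%:M 0) *m givens n c s =
  row_mx (a * c + b * s)%:M (row_mx (b * c - a * s)%:M 0).
Proof.
rewrite /givens (mul_row_block a%:M) mul_row_col mul_row_block mul_mx_row.
rewrite !mul0mx !mulmx0 !addr0 add_row_mx addr0 -!scalar_mxM -!raddfD/=.
by rewrite mulrN (addrC (- _)%R).
Qed.

(** (c, s) is the normalization of (a, b) or of (- a, - b); the sign is the one that makes c
    nonnegative, as the shear decomposition of a rotation requires. *)
Lemma givens_annihilate (a b : R) :
  exists c s, [/\ c ^+ 2 + s ^+ 2 = 1, 0 <= c & b * c - a * s = 0].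
Proof.
have [ab0|ab0] := eqVneq (a ^+ 2 + b ^+ 2) 0.
  exists 1, 0; split => //; first by ring.
  have b0 : b ^+ 2 = 0 by have := sqr_ge0 a; have := sqr_ge0 b; lra.
  by move/eqP : b0; rewrite sqrf_eq0 => /eqP ->; ring.
have abp : 0 < a ^+ 2 + b ^+ 2 by rewrite lt_def ab0 addr_ge0 ?sqr_ge0.
set r := Num.sqrt (a ^+ 2 + b ^+ 2).
have r0 : 0 < r by rewrite sqrtr_gt0.
have r2 : r ^+ 2 = a ^+ 2 + b ^+ 2 by rewrite sqr_sqrtr// ltW.
have rn : r != 0 by rewrite gt_eqF.
have [a0|a0] := leP 0 a.
  exists (a / r), (b / r); split.
  - by rewrite !expr_div_n -mulrDl r2 divff.
  - by rewrite divr_ge0// ltW.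
  - by field.
exists (- a / r), (- b / r); split.
- by rewrite !expr_div_n !sqrrN -mulrDl r2 divff.
- by rewrite divr_ge0 ?ltW// oppr_gt0.
- by field.
Qed.

Lemma mulmx_block1 m n (A : 'M[R]_(m, 1 + n)) (U : 'M[R]_n) :
  A *m block_mx 1%:M 0 0 U = row_mx (lsubmx A) (rsubmx A *m U).
Proof.
by rewrite -{1}[A]hsubmxK mul_row_block mulmx1 !mulmx0 addr0 add0r.
Qed.

(** By induction the tail of the row is rotated onto its first entry, and one Givens rotation then
    merges that entry into the head. *)
Lemma gauss_isometry_row n (s : 'rV[R]_n.+1) :
  exists U : 'M[R]_n.+1, gauss_isometry U /\
    forall j, j != 0 -> (s *m U) 0 j = 0.
Proof.
elim: n => [|n IH] in s *.
  exists 1%:M; split; first exact: gauss_isometry1.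
  by move=> j; rewrite ord1 eqxx.
have [U [gU U0]] := IH (@rsubmx R 1 1 n.+1 s).
set a := (s : 'rV[R]_(1 + n.+1)) 0 (lshift n.+1 0).
set b := (@rsubmx R 1 1 n.+1 s *m U) 0 0.
have [c [t [ct c0 abct]]] := givens_annihilate a b.
exists ((block_mx 1%:M 0 0 U : 'M[R]_(1 + n.+1)) *m givens n c t); split.
  apply: gauss_isometryM; last exact: gauss_isometry_givens.
  by apply: gauss_isometry_block => //; rewrite expr1n.
move=> j j0; rewrite mulmxA.
have -> : s *m (block_mx 1%:M 0 0 U : 'M[R]_(1 + n.+1)) =
    row_mx a%:M (row_mx b%:M 0 : 'rV[R]_(1 + n)) :> 'rV[R]_(1 + (1 + n)).
  rewrite (mulmx_block1 (s : 'rV[R]_(1 + n.+1)) U); congr row_mx.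
    by rewrite [LHS]mx11_scalar mxE.
  apply/rowP => k; have [l ->|l ->] := @split_ordP 1 n k.
    rewrite [RHS]row_mxEl [RHS]mxE !ord1 eqxx mulr1n.
    by congr (_ _ _); apply: val_inj.
  by rewrite [RHS]row_mxEr U0// mxE.
rewrite mul_row_givens abct (_ : (row_mx 0%:M 0 : 'rV[R]_(1 + n)) = 0); last first.
  by rewrite raddf0 row_mx0.
have [k jk|k ->] := @split_ordP 1 n.+1 j; last first.
  by apply: etrans (row_mxEr _ _ _ _) _; rewrite mxE.
by case/eqP: j0; rewrite jk ord1; apply: val_inj.
Qed.

(** The LQ decomposition, by induction on the rows: the first row is rotated onto the first axis,
    and the other rows are reduced on the remaining coordinates. As a result the first m columns of
    U span a space containing the row space of S, and the other columns lie in the kernel. *)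
Lemma gauss_isometry_LQ m n (S : 'M[R]_(m, n)) :
  exists U : 'M[R]_n, gauss_isometry U /\
    forall i (j : 'I_n), (m <= j)%N -> (S *m U) i j = 0.
Proof.
elim: m n S => [|m IH] n S.
  by exists 1%:M; split; [exact: gauss_isometry1|case].
case: n S => [|n] S.
  by exists 1%:M; split; [exact: gauss_isometry1|move=> i []].
have [U [gU U0]] := gauss_isometry_row (@usubmx R 1 m n.+1 S).
have [V [gV V0]] := IH n (@rsubmx R m 1 n (@dsubmx R 1 m n.+1 S *m U)).
exists (U *m (block_mx 1%:M 0 0 V : 'M[R]_(1 + n))); split.
  apply: gauss_isometryM => //.
  by apply: gauss_isometry_block => //; rewrite expr1n.
move=> i j mj; rewrite mulmxA.
have [k jk|k jk] := @split_ordP 1 n j.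
  by move: mj; rewrite jk /= ord1.
rewrite jk; transitivity ((@rsubmx R m.+1 1 n (S *m U) *m V) i k).
  by rewrite (mulmx_block1 (S *m U : 'M[R]_(m.+1, 1 + n)) V); exact: row_mxEr.
have [l ->|l ->] := @split_ordP 1 m i.
  rewrite mxE big1// => q _; rewrite [X in X * _]mxE.
  rewrite [X in X * _](_ : _ = (@usubmx R 1 m n.+1 S *m U) 0 (rshift 1 q)).
    by rewrite U0 ?mul0r.
  by rewrite !mxE; apply: eq_bigr => x _; rewrite mxE ord1.
rewrite -(V0 l k); last by move: mj; rewrite jk /=.
rewrite !mxE; apply: eq_bigr => q _; congr (_ * _); rewrite !mxE.
by apply: eq_bigr => x _; rewrite mxE.
Qed.

Definition sign_diag m n : 'M[R]_n :=
  diag_mx (\row_(j < n) (if (j < m)%N then 1 else -1)).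

Lemma gauss_isometry_sign_diag m n : gauss_isometry (sign_diag m n).
Proof.
elim: n m => [|n IH] m.
  rewrite (_ : sign_diag m 0 = 1%:M); first exact: gauss_isometry1.
  by apply/matrixP => -[].
rewrite (_ : sign_diag m n.+1 =
  (block_mx (if (0 < m)%N then 1 else - 1)%:M 0 0 (sign_diag m.-1 n) : 'M[R]_(1 + n))).
  apply: gauss_isometry_block => //; case: ifP => _; first by rewrite expr1n.
  by rewrite sqrrN expr1n.
apply/matrixP => i j.
have [k ->|k ->] := @split_ordP 1 n i; have [l ->|l ->] := @split_ordP 1 n j.
- by rewrite [RHS](block_mxEul _ _ _ (sign_diag m.-1 n)) !mxE !ord1.
- by rewrite [RHS](block_mxEur _ _ _ (sign_diag m.-1 n)) !mxE ord1.
- by rewrite [RHS](block_mxEdl _ _ _ (sign_diag m.-1 n)) !mxE ord1.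
- rewrite [RHS](block_mxEdr _ _ _ (sign_diag m.-1 n)) !mxE.
  by rewrite (inj_eq (@rshift_inj 1 n)) /=; case: m => [|m].
Qed.

End Reflection.

(** * Moments and tail estimates *)

Section Expectation.
Context {R : realType}.
Local Notation gauss := (normal_prob (0 : R) 1).

Lemma measurable_ltr d (T : measurableType d) (f : T -> R) (lambda : R) :
  measurable_fun setT f -> measurable [set x | lambda < f x].
Proof.
move=> mf; rewrite -[X in measurable X]setTI.
rewrite (_ : [set x | lambda < f x] = f @^-1` `]lambda, +oo[); last first.
  by apply/seteqP; split => x /=; rewrite in_itv /= andbT.
exact: mf.
Qed.

Lemma markov_ineq d (T : measurableType d) (mu : {measure set T -> \bar R})
    (f : T -> R) (lambda : R) :
  measurable_fun setT f -> (forall x, 0 <= f x) -> 0 <= lambda ->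
  (lambda%:E * mu [set x | (lambda < f x)%R] <= \int[mu]_x (f x)%:E)%E.
Proof.
move=> mf f0 l0; have mA := measurable_ltr lambda mf.
rewrite -[X in (_ * mu X)%E]setIT -integral_indic//.
rewrite -ge0_integralZl//; last exact/measurable_EFinP/measurable_indic.
apply: ge0_le_integral => //.
- by move=> x _; rewrite mule_ge0// lee_fin.
- by apply: emeasurable_funM => //; exact/measurable_EFinP/measurable_indic.
- exact/measurable_EFinP.
move=> x _; rewrite -EFinM lee_fin indicE.
case: (boolP (x \in _)) => [/set_mem /= /ltW|]; first by rewrite mulr1.
by rewrite mulr0.
Qed.

Lemma gaussvec_coord n (i : 'I_n) (Y : set R) : measurable Y ->
  gaussvec n [set v | Y ((v : 'cV[R]_n) i 0)] = gauss Y.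
Proof.
elim: n i => [[]//|n IH] i mY; rewrite gaussvec_consE.
have [k ->|->] := unliftP 0 i.
  transitivity (\int[gauss]_a cst (gauss Y) a)%E.
    apply: eq_integral => a _; rewrite /= -(IH k)//; congr (gaussvec n _).
    by apply/seteqP; split => v /=; rewrite cons_vecS.
  by rewrite integral_cst// [X in (_ * X)%E]probability_setT mule1.
transitivity (\int[gauss]_a (\1_Y a)%:E)%E; last by rewrite integral_indic// setIT.
apply: eq_integral => a _; rewrite indicE.
rewrite (_ : [set v | _] = [set v : borel_mx R n 1 | Y a]); last first.
  by apply/seteqP; split => v /=; rewrite cons_vec0.
case: (boolP (a \in Y)) => [/set_mem Ya|/negP Ya].
  by rewrite (_ : [set v | _] = setT) ?probability_setT//; apply/seteqP; split.
rewrite (_ : [set v | _] = set0) ?measure0//; apply/seteqP; split => // v /= Ya'.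
by apply: Ya; exact/mem_set.
Qed.

Lemma integral_gaussvec_coord n (i : 'I_n) (g : R -> \bar R) :
  measurable_fun setT g -> (forall x, 0 <= g x)%E ->
  (\int[gaussvec n]_v g ((v : 'cV[R]_n) i 0%R) = \int[gauss]_x g x)%E.
Proof.
move=> mg g0.
have mi : measurable_fun [set: borel_mx R n 1]
    (fun v => (v : 'cV[R]_n) i 0 : measurableTypeR R) := measurable_mx_entry i 0.
rewrite -[LHS](ge0_integral_pushforward mi (gaussvec n) measurableT)//.
by apply: eq_measure_integral => A mA _; exact: gaussvec_coord.
Qed.

Lemma integral_gauss_isometry n (U : 'M[R]_n) (g : borel_mx R n 1 -> \bar R) :
  gauss_isometry U -> measurable_fun setT g -> (forall x, 0 <= g x)%E ->
  (\int[gaussvec n]_v g (U *m (v : 'cV[R]_n)) = \int[gaussvec n]_v g v)%E.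
Proof.
move=> [_ gU] mg g0.
apply: (@ge0_integral_preserving _ _ _ _ (fun v : borel_mx R n 1 =>
   (U *m (v : 'cV[R]_n) : borel_mx R n 1)) g) => //.
by apply: measurable_mulmxr; exact: measurable_id.
Qed.

Lemma integral_gaussvec_sum n (I : Type) (s : seq I) (w : I -> 'I_n) (g : R -> R) :
  measurable_fun setT g -> (forall x, 0 <= g x) ->
  (\int[gaussvec n]_v (\sum_(i <- s) g ((v : 'cV[R]_n) (w i) 0))%R%:E =
   (size s)%:R%:E * \int[gauss]_x (g x)%:E)%E.
Proof.
move=> mg g0; under eq_integral do rewrite -sumEFin.
have mgi i : measurable_fun setT
    (fun v : borel_mx R n 1 => (g ((v : 'cV[R]_n) (w i) 0))%:E).
  apply/measurable_EFinP.
  exact: (measurableT_comp mg (measurable_mx_entry (w i) 0)).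
rewrite ge0_integral_sum//; last by move=> i x _; rewrite lee_fin.
under eq_bigr => i _.
  rewrite (@integral_gaussvec_coord n (w i) (EFin \o g))//; last first.
  exact/measurable_EFinP.
  over.
by rewrite big_const_seq count_predT iter_addr_0 mule_natl.
Qed.

End Expectation.

(** * Averaging over the input and reflecting it *)

Section Averaging.
Context {R : realType}.

(* The Borel sets B and C enclosing the success event have the same mass, so
   the sections of C, each of mass at least p, bound the mass of B. *)
Lemma success_mass (m n n' d k : nat) (eps p : R)
    (D : probability (borel_mx R m n) R) (E : estimator R m d)
    (A : 'M[R]_(n, d)) (F : 'M[R]_(n, n')) (b0 : 'cV[R]_n) :
  0 <= p -> oblivious_linear_sketch k eps p D E ->
  exists B : set (borel_mx R m n * borel_mx R n' 1),
    [/\ measurable B,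
     forall S b, B (S, b) -> sketch_succeeds k eps E S A (F *m b + b0) &
     (p%:E <= \int[D]_S gaussvec n' (xsection B S))%E].
Proof.
move=> p0 [um succ].
pose Phi (w : borel_mx R m n * borel_mx R n' 1) :
  borel_mx R m n * (borel_mx R n d * borel_mx R n 1) :=
  (w.1, (A : borel_mx R n d, (F *m (w.2 : 'cV[R]_n') + b0 : 'cV[R]_n))).
have mPhi : measurable_fun setT Phi.
  apply/measurable_fun_pairP; split; first exact: measurable_fst.
  apply/measurable_fun_pairP; split => /=; first exact: measurable_cst.
  apply: measurable_fun_mx => i j.
  under eq_fun do rewrite mxE; apply: measurable_funD => //.
  apply: (measurableT_comp (measurable_mx_entry i j)).
  exact: (measurable_mulmxr F measurable_snd).
have mpre Y : measurable Y -> measurable (Phi @^-1` Y).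
  by move=> mY; rewrite -[X in measurable X]setTI; exact: mPhi.
pose Phi' : {mfun _ >-> _} := HB.pack Phi (isMeasurableFun.Build _ _ _ _ Phi mPhi).
(* Universal measurability is applied to the joint law of the sketch and the random input, that is,
   to the image of the product measure under [Phi]. *)
have [B [C [mB mC BG GC CB]]] := um (distribution (D \x gaussvec n')%E Phi').
exists (Phi @^-1` B); split; first exact: mpre.
  by move=> S b /BG.
have -> : (\int[D]_S gaussvec n' (xsection (Phi @^-1` B) S) =
    (D \x gaussvec n') (Phi @^-1` C))%E.
  transitivity ((D \x gaussvec n')%E (Phi @^-1` B)) => //.
  have -> : Phi @^-1` C = Phi @^-1` B `|` Phi @^-1` (C `\` B).
    by rewrite -preimage_setU setDUK//; apply: subset_trans GC.
  by rewrite measureU0//; [exact: mpre|apply: mpre; exact: measurableD].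
have mA := mpre C mC.
rewrite -[leRHS]/(\int[D]_S (gaussvec n' \o xsection (Phi @^-1` C)) S)%E.
rewrite -(indic_fubini_tonelli_FE _ mA) (indic_fubini_tonelli _ _ mA).
rewrite (indic_fubini_tonelli_GE _ mA).
apply: (@le_trans _ _ (\int[gaussvec n']_b cst p%:E b)%E).
  by rewrite integral_cst// [X in (_ * X)%E]probability_setT mule1.
apply: ge0_le_integral => //; first exact: measurable_fun_ysection.
move=> b _.
have [Bb [mBb BbG pB]] := succ A (F *m b + b0).
apply: (le_trans pB); apply: le_measure; rewrite ?inE//.
  exact: measurable_ysection.
move=> S BbS; rewrite /ysection /= inE; apply: GC.
exact: BbG.
Qed.

(** If every S had total success mass below q times the number of indices, so would the average over
    D, but that average is at least p times this number. One S has to serve all indices, because the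
    index plays the part of randomness unknown to the sketch. *)
Lemma exists_good_sketch (I : finType) (m n n' d k : nat) (eps p q : R)
    (D : probability (borel_mx R m n) R) (E : estimator R m d)
    (A : I -> 'M[R]_(n, d)) (F : 'M[R]_(n, n')) (b0 : 'cV[R]_n) :
  0 <= q -> q < p -> oblivious_linear_sketch k eps p D E ->
  exists (S : 'M[R]_(m, n)) (X : I -> set (borel_mx R n' 1)),
    [/\ forall i, measurable (X i),
     forall i b, X i b -> sketch_succeeds k eps E S (A i) (F *m b + b0) &
     ((q * #|I|%:R)%:E <= \sum_i gaussvec n' (X i))%E].
Proof.
move=> q0 qp obl; have p0 : 0 <= p by rewrite (le_trans q0)// ltW.
have /choice[B hB] := fun i => success_mass (A i) F b0 p0 obl.
have mf i : measurable_fun setT (fun S => gaussvec n' (xsection (B i) S)).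
  by have [mB _ _] := hB i; exact: measurable_fun_xsection.
apply: contrapT => noS.
have lt_q S : (\sum_i gaussvec n' (xsection (B i) S) < (q * #|I|%:R)%:E)%E.
  rewrite ltNge; apply/negP => le_q; apply: noS.
  exists S, (fun i => xsection (B i) S); split => // i.
    by have [mB _ _] := hB i; exact: measurable_xsection.
  by move=> b; have [_ BG _] := hB i; rewrite /xsection /= inE => /BG.
have I0 : (0 < #|I|)%N.
  rewrite lt0n; apply/eqP => I0; have := lt_q 0.
  by rewrite I0 mulr0 big_pred0 ?ltxx// => i; have := fintype0 i I0.
have : (\int[D]_S (\sum_i gaussvec n' (xsection (B i) S)) <= (q * #|I|%:R)%:E)%E.
  apply: (@le_trans _ _ (\int[D]_S cst (q * #|I|%:R)%:E S)%E).
    apply: ge0_le_integral => //.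
    - by move=> S _; apply: sume_ge0.
    - exact: emeasurable_sum.
    - by move=> S _; apply/ltW.
  by rewrite integral_cst// [X in (_ * X)%E]probability_setT mule1.
rewrite ge0_integral_sum//; apply/negP; rewrite -ltNge.
apply: (@lt_le_trans _ _ (\sum_(i : I) p%:E)%E).
  rewrite sumEFin sumr_const.
  by rewrite -[p *+ _]mulr_natr lte_fin ltr_pM2r// ltr0n.
by apply: lee_sum => i _; have [_ _] := hB i.
Qed.

End Averaging.

(** * One answer for an input and its reflection *)

Section Collision.
Context {R : realType}.

Definition low_diag m n : 'M[R]_n := diag_mx (\row_(j < n) (j < m)%N%:R).

(** For U from [gauss_isometry_LQ], this fixes the span of the first m columns of U, which contains
    the row space of the sketch and may exceed it. It equals [2 *: lowproj m U - 1%:M] when U is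
    orthogonal, and [lowproj] is the orthogonal projection P onto that span. *)
Definition reflection m n (U : 'M[R]_n) : 'M[R]_n :=
  U *m sign_diag m n *m U^T.

Definition lowproj m n (U : 'M[R]_n) : 'M[R]_n := U *m low_diag m n *m U^T.

Lemma gauss_isometry_reflection m n (U : 'M[R]_n) :
  gauss_isometry U -> gauss_isometry (reflection m U).
Proof.
move=> gU; apply: gauss_isometryM; last exact: gauss_isometry_tr.
by apply: gauss_isometryM => //; exact: gauss_isometry_sign_diag.
Qed.

Lemma add_reflection m n (U : 'M[R]_n) (v : 'cV[R]_n) : U^T *m U = 1%:M ->
  v + reflection m U *m v = 2 *: (lowproj m U *m v).
Proof.
move=> /mulmx1C UU; rewrite -{1}[v]mul1mx -mulmxDl scalemxAl; congr (_ *m _).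
rewrite -UU -{1}[U]mulmx1 -mulmxDl -mulmxDr scalemxAl scalemxAr; congr (_ *m _ *m _).
apply/matrixP => i j; rewrite !mxE; case: eqP => [->|_] /=; last first.
  by rewrite !mulr0n addr0 mulr0.
by case: (j < m)%N; rewrite /= ?mulr1n; ring.
Qed.

Lemma mulmx_reflection m n (S : 'M[R]_(m, n)) (U : 'M[R]_n) : U^T *m U = 1%:M ->
  (forall i (j : 'I_n), (m <= j)%N -> (S *m U) i j = 0) ->
  S *m reflection m U = S.
Proof.
move=> /mulmx1C UU SU0; rewrite /reflection !mulmxA.
rewrite -[RHS]mulmx1 -UU mulmxA; congr (_ *m _).
apply/matrixP => i j; rewrite mul_mx_diag mxE [X in _ * X]mxE.
by case: ltnP => [_|mj]; rewrite ?mulr1// SU0// mul0r.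
Qed.

(* The reflection fixes S *m F, hence the sketch: with probability at least
   2 q - 1 the same minimizer x has to serve both b and its reflection. *)
Lemma collision (I : finType) (m n n' d k : nat) (eps p : R)
    (D : probability (borel_mx R m n) R) (E : estimator R m d)
    (A : I -> 'M[R]_(n, d)) (F : 'M[R]_(n, n')) (b0 : 'cV[R]_n) (q : R) :
  2^-1 <= q -> q < p -> oblivious_linear_sketch k eps p D E ->
  exists U : 'M[R]_n', gauss_isometry U /\
    forall bad : I -> set (borel_mx R n' 1),
      (forall i, measurable (bad i)) ->
      \sum_i fine (gaussvec n' (bad i)) < (2 * q - 1) * #|I|%:R ->
      exists i (b : 'cV[R]_n') x, [/\ ~ bad i b, sparse k x,
        l2norm (A i *m x - (F *m b + b0)) <=
          (1 + eps) * sparse_opt k (A i) (F *m b + b0) &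
        l2norm (A i *m x - (F *m (reflection m U *m b) + b0)) <=
          (1 + eps) * sparse_opt k (A i) (F *m (reflection m U *m b) + b0)].
Proof.
move=> q2 qp obl; have q0 : 0 <= q by apply: le_trans q2.
have [S [X [mX XS qX]]] := exists_good_sketch A F b0 q0 qp obl.
have [U [gU U0]] := gauss_isometry_LQ (S *m F).
have [UU _] := gU.
(* The events [bad] are chosen after U, since they will include the event that the projection of b
   is large. *)
exists U; split => // bad mbad bad_lt.
have gr := gauss_isometry_reflection m gU.
apply: contrapT => nogood.
pose X' i : set (borel_mx R n' 1) := [set b | X i (reflection m U *m (b : 'cV[R]_n'))].
have mX' i : measurable (X' i) by exact: measurable_mulmx_preimage.
have Xbad i : X i `&` X' i `<=` bad i.
  move=> b [Xb X'b]; apply: contrapT => nbad; apply: nogood.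
  have [[x xarg] sb] := XS i b Xb.
  have [_ sb'] := XS i _ X'b.
  exists i, b, x; split => //; first by case: xarg.
    exact: sb.
  apply: sb'.
  rewrite mulmxDr (mulmxA S F) (mulmxA (S *m F)) mulmx_reflection//.
  by rewrite -mulmxA -mulmxDr.
pose r (Y : set (borel_mx R n' 1)) : R := fine (gaussvec n' Y).
have rE Y : measurable Y -> gaussvec n' Y = (r Y)%:E.
  by move=> mY; rewrite fineK// fin_num_measure.
(* The reflection preserves the law, so [X' i] is as likely as [X i]; a union bound on the
   complements leaves [2 * r (X i) - 1] for both. *)
have le_bad i : 2 * r (X i) - 1 <= r (bad i).
  have mC := measurableC (mX' i).
  have : (gaussvec n' (X i) <= gaussvec n' (~` X' i) + gaussvec n' (bad i))%E.
    apply: le_trans (measureU2 _ _ _) => //.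
    apply: le_measure; rewrite ?inE//; first exact: measurableU.
    by move=> b Xb; have [X'b|nX'b] := pselect (X' i b); [right; apply: Xbad|left].
  rewrite probability_setC// {1}/X' (gr.2 _ (mX i)) !rE// -EFinB -EFinD lee_fin.
  lra.
move: bad_lt qX; rewrite (eq_bigr (fun i => (r (X i))%:E)); last first.
  by move=> i _; rewrite rE.
rewrite sumEFin lee_fin.
have : \sum_i (2 * r (X i) - 1) <= \sum_i r (bad i) by apply: ler_sum.
rewrite sumrB -mulr_sumr sumr_const => h1 h2 h3.
have {}h1 : 2 * \sum_i r (X i) - #|I|%:R <= \sum_i r (bad i) := h1.
by move: h1 h2 h3; rewrite mulrBl mul1r -mulrA; lra.
Qed.

End Collision.

(** * Squared residuals and Markov bounds *)

Section Estimates.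
Context {R : realType}.
Local Notation gauss := (normal_prob (0 : R) 1).

Definition sqn n (v : 'cV[R]_n) : R := \sum_i v i 0 ^+ 2.

Lemma sqn_ge0 n (v : 'cV[R]_n) : 0 <= sqn v.
Proof. by apply: sumr_ge0 => i _; exact: sqr_ge0. Qed.

Lemma l2norm_sqn n (v : 'cV[R]_n) : l2norm v ^+ 2 = sqn v.
Proof. by rewrite sqr_sqrtr// sqn_ge0. Qed.

Lemma sqn_col_mx m n (u : 'cV[R]_m) (v : 'cV[R]_n) :
  sqn (col_mx u v) = sqn u + sqn v.
Proof.
rewrite /sqn big_split_ord /=; congr (_ + _); apply: eq_bigr => i _.
  by rewrite col_mxEu.
by rewrite col_mxEd.
Qed.

Lemma sqn0 n : sqn (0 : 'cV[R]_n) = 0.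
Proof. by rewrite /sqn big1// => i _; rewrite mxE expr0n. Qed.

Lemma sqnB n (u v : 'cV[R]_n) :
  sqn (u - v) = sqn u + sqn v - 2 * \sum_i u i 0 * v i 0.
Proof.
rewrite /sqn mulr_sumr -big_split -sumrB; apply: eq_bigr => i _ /=.
by rewrite !mxE; ring.
Qed.

Lemma sqn_isometry n (U : 'M[R]_n) (v : 'cV[R]_n) :
  U^T *m U = 1%:M -> sqn (U *m v) = sqn v.
Proof.
move=> UU; have sqnE (w : 'cV[R]_n) : sqn w = (w^T *m w) 0 0.
  by rewrite mxE; apply: eq_bigr => i _; rewrite mxE expr2.
by rewrite !sqnE trmx_mul mulmxA -(mulmxA v^T) UU mulmx1.
Qed.

Lemma parallelogram_reflection m n (U : 'M[R]_n) (v y : 'cV[R]_n) :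
  gauss_isometry U ->
  sqn (y - v) + sqn (y - reflection m U *m v) =
  2 * sqn v + 2 * sqn y - 4 * \sum_i y i 0 * (lowproj m U *m v) i 0.
Proof.
move=> gU; have [UU _] := gU; rewrite !sqnB.
rewrite (sqn_isometry v (gauss_isometry_reflection m gU).1).
have : \sum_i y i 0 * v i 0 + \sum_i y i 0 * (reflection m U *m v) i 0 =
    2 * \sum_i y i 0 * (lowproj m U *m v) i 0.
  rewrite -big_split mulr_sumr; apply: eq_bigr => i _ /=; rewrite -mulrDr.
  have /colP/(_ i) := add_reflection m v UU; rewrite !mxE => ->.
  ring.
lra.
Qed.

Lemma sparse_opt_le n d k (A : 'M[R]_(n, d)) (b : 'cV[R]_n) x : sparse k x ->
  sparse_opt k A b <= l2norm (A *m x - b).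
Proof.
move=> sx; apply: ge_inf; last by exists x.
by exists 0 => _ [y _ <-]; exact: sqrtr_ge0.
Qed.

Lemma success_sqn n d k (A : 'M[R]_(n, d)) (b u : 'cV[R]_n) x (eps V : R) :
  0 <= eps -> sparse k x -> sqn (A *m x - b) <= V ->
  l2norm u <= (1 + eps) * sparse_opt k A b -> sqn u <= (1 + eps) ^+ 2 * V.
Proof.
move=> e0 sx xV hu; have e1 : 0 <= 1 + eps by rewrite addr_ge0.
have {}hu : l2norm u <= (1 + eps) * l2norm (A *m x - b).
  by apply: (le_trans hu); rewrite ler_wpM2l// sparse_opt_le.
rewrite -l2norm_sqn; apply: le_trans (_ : ((1 + eps) * l2norm (A *m x - b)) ^+ 2 <= _).
  by rewrite lerXn2r// ?nnegrE ?mulr_ge0 ?sqrtr_ge0.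
by rewrite exprMn l2norm_sqn ler_wpM2l// sqr_ge0.
Qed.

Definition gprob n (X : set (borel_mx R n 1)) : R := fine (gaussvec n X).

Lemma gprobE n (X : set (borel_mx R n 1)) : measurable X ->
  gaussvec n X = (gprob X)%:E.
Proof. by move=> mX; rewrite fineK// fin_num_measure. Qed.

Lemma gprobU n (X Y : set (borel_mx R n 1)) : measurable X -> measurable Y ->
  gprob (X `|` Y) <= gprob X + gprob Y.
Proof.
move=> mX mY; rewrite -lee_fin EFinD -!gprobE//; first exact: measureU2.
exact: measurableU.
Qed.

Lemma gprob_isometry n (U : 'M[R]_n) (X : set (borel_mx R n 1)) :
  gauss_isometry U -> measurable X ->
  gprob [set v | X (U *m (v : 'cV[R]_n))] = gprob X.
Proof. by move=> [_ gU] mX; rewrite /gprob gU. Qed.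

Lemma gprob_markov n (f : borel_mx R n 1 -> R) (lambda K : R) :
  measurable_fun setT f -> (forall x, 0 <= f x) -> 0 <= lambda ->
  (\int[gaussvec n]_v (f v)%:E <= K%:E)%E ->
  lambda * gprob [set v | lambda < f v] <= K.
Proof.
move=> mf f0 l0 fK; rewrite -lee_fin EFinM -gprobE; last exact: measurable_ltr.
by apply: le_trans fK; exact: markov_ineq.
Qed.

Lemma measurable_coord_sum n (I : Type) (s : seq I) (w : I -> 'I_n) (g : R -> R) :
  measurable_fun setT g ->
  measurable_fun setT
    (fun v : borel_mx R n 1 => \sum_(i <- s) g ((v : 'cV[R]_n) (w i) 0)).
Proof.
move=> mg; apply: measurable_sum => i.
exact: (measurableT_comp mg (measurable_mx_entry (w i) 0)).
Qed.

Lemma integral_gaussvec_sum_le n (I : finType) (w : I -> 'I_n) (g : R -> R) (K : R) :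
  measurable_fun setT g -> (forall x, 0 <= g x) ->
  (\int[gauss]_x (g x)%:E <= K%:E)%E ->
  (\int[gaussvec n]_v (\sum_i g ((v : 'cV[R]_n) (w i) 0))%R%:E <= (#|I|%:R * K)%:E)%E.
Proof.
move=> mg g0 gK; rewrite integral_gaussvec_sum// EFinM.
by rewrite /index_enum -enumT -cardE lee_wpmul2l// lee_fin.
Qed.

Lemma measurable_sqn n :
  measurable_fun setT (fun v : borel_mx R n 1 => sqn (v : 'cV[R]_n)).
Proof.
have mg : measurable_fun setT (fun x : R => x ^+ 2) by exact: measurable_funX.
exact: (measurable_coord_sum _ id mg).
Qed.

Lemma gprob_sqn n (lambda : R) : 0 <= lambda ->
  lambda * gprob [set v : borel_mx R n 1 | lambda < sqn (v : 'cV[R]_n)] <= n%:R * 65.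
Proof.
move=> l0; rewrite -[n in n%:R]card_ord.
have mg : measurable_fun setT (fun x : R => x ^+ 2) by exact: measurable_funX.
apply: gprob_markov => //.
- exact: measurable_sqn.
- by move=> v; exact: sqn_ge0.
apply: (@integral_gaussvec_sum_le n 'I_n id _ _ mg).
- by move=> x; exact: sqr_ge0.
- exact: gauss_second_moment.
Qed.

Definition small (a x : R) : R := \1_[set x : R | `|x| < a] x.

Lemma measurable_small (a : R) : measurable_fun setT (small a).
Proof.
apply: measurable_indic; rewrite (_ : [set x : R | _] = `]- a, a[%classic).
  exact: measurable_itv.
by apply/seteqP; split => x /=; rewrite in_itv /= ltr_norml.
Qed.

Lemma small_lb (a x : R) : 0 <= a -> a * (1 - small a x) <= `|x|.
Proof.
move=> a0; rewrite /small indicE; case: (boolP (x \in _)).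
  by move=> _; rewrite subrr mulr0.
by move=> /negP h; rewrite subr0 mulr1 leNgt; apply/negP => xa; apply: h; apply/mem_set.
Qed.

(** A coordinate is small with probability at most a, so Markov bounds by 2a the chance that more
    than half of them are. *)
Lemma gprob_small n (I : finType) (w : I -> 'I_n) (a : R) :
  0 <= a -> (0 < #|I|)%N ->
  gprob [set v : borel_mx R n 1 |
    #|I|%:R / 2 < \sum_i small a ((v : 'cV[R]_n) (w i) 0)] <= 2 * a.
Proof.
move=> a0 I0; have I0' : 0 < #|I|%:R :> R by rewrite ltr0n.
have mg := measurable_small a.
have : #|I|%:R / 2 * gprob [set v : borel_mx R n 1 |
    #|I|%:R / 2 < \sum_i small a ((v : 'cV[R]_n) (w i) 0)] <= #|I|%:R * a.
  apply: gprob_markov.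
  - exact: measurable_coord_sum.
  - by move=> v; apply: sumr_ge0.
  - by rewrite divr_ge0.
  apply: integral_gaussvec_sum_le => //.
  rewrite integral_indic//.
    by rewrite setIT; exact: gauss_small_ball.
  by rewrite (_ : [set x : R | _] = `]- a, a[%classic)//;
    apply/seteqP; split => x /=; rewrite in_itv /= ltr_norml.
by rewrite -mulrA ler_pM2l//; lra.
Qed.

Lemma sum_abs_lb n (I : finType) (w : I -> 'I_n) (a : R) (v : 'cV[R]_n) : 0 <= a ->
  ~ (#|I|%:R / 2 < \sum_i small a (v (w i) 0)) ->
  a * (#|I|%:R / 2) <= \sum_i `|v (w i) 0|.
Proof.
move=> a0 /negP; rewrite -leNgt => h.
apply: (@le_trans _ _ (\sum_i a * (1 - small a (v (w i) 0)))); last first.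
  by apply: ler_sum => i _; exact: small_lb.
rewrite -mulr_sumr ler_wpM2l// sumrB.
have -> : \sum_(i : I) (1 : R) = #|I|%:R by rewrite sumr_const.
lra.
Qed.

Lemma sqn_lb n (a : R) (v : 'cV[R]_n) : 0 <= a ->
  ~ (#|'I_n|%:R / 2 < \sum_i small a (v i 0)) ->
  a ^+ 2 * (n%:R / 2) <= sqn v.
Proof.
move=> a0 /negP; rewrite -leNgt card_ord => h.
apply: (@le_trans _ _ (\sum_i a ^+ 2 * (1 - small a (v i 0)))); last first.
  apply: ler_sum => i _; have := small_lb (v i 0) a0.
  rewrite /small indicE; case: (_ \in _) => /=.
    by rewrite subrr !mulr0 => _; exact: sqr_ge0.
  by rewrite subr0 !mulr1 => ha; rewrite -[leRHS]real_normK ?num_real// lerXn2r ?nnegrE.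
rewrite -mulr_sumr ler_wpM2l ?sqr_ge0// sumrB sumr_const card_ord; lra.
Qed.

Lemma measurable_mulmx_comp m n (U : 'M[R]_(m, n)) (f : borel_mx R m 1 -> R) :
  measurable_fun setT f ->
  measurable_fun setT (fun v : borel_mx R n 1 => f (U *m (v : 'cV[R]_n))).
Proof.
move=> mf; apply: (measurableT_comp mf).
by apply: measurable_mulmxr; exact: measurable_id.
Qed.

(** U^T v is again Gaussian, and the projection keeps at most m of its coordinates, each of second
    moment at most 65. *)
Lemma integral_sqn_lowproj m n (U : 'M[R]_n) : gauss_isometry U ->
  (\int[gaussvec n]_v (sqn (lowproj m U *m (v : 'cV[R]_n)))%:E <= (m%:R * 65)%:E)%E.
Proof.
move=> gU; have [UU _] := gU.
pose s := [seq j : 'I_n <- enum 'I_n | (j < m)%N].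
have mg : measurable_fun setT (fun x : R => x ^+ 2) by exact: measurable_funX.
have E (v : 'cV[R]_n) : sqn (lowproj m U *m v) = \sum_(j <- s) (U^T *m v) j 0 ^+ 2.
  rewrite /lowproj -!mulmxA sqn_isometry// /s big_filter big_enum_cond /=.
  rewrite [RHS]big_mkcond /=; apply: eq_bigr => j _.
  rewrite mul_diag_mx mxE [X in X * _]mxE.
  by case: ifP; rewrite ?mul1r ?mul0r ?expr0n.
under eq_integral do rewrite E.
have mf := measurable_coord_sum s id mg.
rewrite (@integral_gauss_isometry _ _ U^T
  (fun v => (\sum_(j <- s) (v : 'cV[R]_n) j 0 ^+ 2)%:E)); last 3 first.
- exact: gauss_isometry_tr.
- exact/measurable_EFinP.
- by move=> v; rewrite lee_fin; apply: sumr_ge0 => j _; exact: sqr_ge0.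
rewrite (@integral_gaussvec_sum _ _ _ s id _ mg); last first.
  by move=> x; exact: sqr_ge0.
have sm : (size s <= m)%N.
  rewrite -(size_map (@nat_of_ord n)) -[leqRHS](size_iota 0); apply: uniq_leq_size.
    by rewrite (map_inj_uniq (@ord_inj n)) filter_uniq ?enum_uniq.
  by move=> _ /mapP[j + ->]; rewrite mem_filter mem_iota add0n => /andP[].
rewrite EFinM; apply: lee_pmul => //.
- by apply: integral_ge0 => x _; rewrite lee_fin sqr_ge0.
- by rewrite lee_fin ler_nat.
- exact: gauss_second_moment.
Qed.

End Estimates.

(** * Designs made of blocks of columns *)

Section Blocks.
Context {R : realType}.

(** Designs are described by codes while columns are numbered by ['I_d]; the surplus columns repeat
    the code [x0]. *)
Lemma exists_decoder (T : finType) (P : {pred T}) (x0 : T) (d : nat) :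
  (#|P| <= d)%N ->
  exists dec : 'I_d -> T, forall x, x \in P -> exists j, dec j = x.
Proof.
move=> Pd; exists (fun j => nth x0 (enum P) j) => x xP.
have xd : (index x (enum P) < d)%N.
  by rewrite (leq_trans _ Pd)// cardE index_mem mem_enum.
by exists (Ordinal xd); rewrite /= nth_index// mem_enum.
Qed.

(** Pigeonhole: k nonzero block sums already use up all k nonzero entries, so no block can hold a
    second one. *)
Lemma sparse_block k d (blk : 'I_d -> 'I_k) (x : 'cV[R]_d) : sparse k x ->
  (forall i, \sum_(j | blk j == i) x j 0 != 0) ->
  forall i, exists j, blk j = i /\ forall j', blk j' = i -> j' != j -> x j' 0 = 0.
Proof.
rewrite /sparse /l0norm /= => sx bx.
have /choice[f hf] : forall i, exists j, blk j = i /\ x j 0 != 0.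
  move=> i; apply: contrapT => nj; have /eqP := bx i; apply.
  apply: big1 => j /eqP bj; apply/eqP; apply: contrapT => /negP xj.
  by apply: nj; exists j.
have finj : injective f.
  by move=> i i' ff; rewrite -(hf i).1 -(hf i').1 ff.
have fsupp : f @: [set: 'I_k]%SET = [set i : 'I_d | x i 0 != 0]%SET.
  apply/eqP; rewrite eqEcard card_imset// cardsT card_ord sx andbT.
  by apply/fintype.subsetP => _ /imsetP[i _ ->]; rewrite inE (hf i).2.
move=> i; exists (f i); split; first exact: (hf i).1.
move=> j bj jf; apply/eqP; apply: contraT => xj.
have : j \in f @: [set: 'I_k]%SET by rewrite fsupp inE.
move=> /imsetP[i' _ ji']; move: jf; rewrite ji'; move: bj.
by rewrite ji' (hf i').1 => ->; rewrite eqxx.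
Qed.

Definition selector k d (blk : 'I_d -> 'I_k) (enc : 'I_k -> 'I_d) : 'cV[R]_d :=
  \col_j (enc (blk j) == j)%:R.

Lemma sparse_selector k d (blk : 'I_d -> 'I_k) (enc : 'I_k -> 'I_d) :
  sparse k (selector blk enc).
Proof.
rewrite /sparse /l0norm /=.
apply: (@leq_trans #|(enc @: [set: 'I_k])%SET|); last first.
  by apply: leq_trans (leq_imset_card _ _) _; rewrite cardsT card_ord.
apply: subset_leq_card; apply/fintype.subsetP => j; rewrite inE mxE.
case: (enc (blk j) =P j) => [<- _|_]; last by rewrite eqxx.
by apply/imsetP; exists (blk j).
Qed.

Lemma sum_selector k d (blk : 'I_d -> 'I_k) (enc : 'I_k -> 'I_d) (f : 'I_d -> R) i :
  cancel enc blk ->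
  \sum_(j | blk j == i) f j * selector blk enc j 0 = f (enc i).
Proof.
move=> encK; rewrite (bigD1 (enc i)) ?encK//= mxE encK eqxx mulr1.
rewrite big1 ?addr0// => j /andP[/eqP bj ji]; rewrite mxE bj eq_sym.
by rewrite (negbTE ji) mulr0.
Qed.

Section QuantMatrix.
Variables (k k' L N d : nat) (B : finType) (w : 'I_k' * 'I_L -> 'I_N).
Variables (val : B -> R) (dec : 'I_d -> 'I_k * {ffun 'I_L -> B}).

(* Column j holds the vector of values encoded by the second component of
   dec j, on the window coordinates w of the block (dec j).1; the blocks
   from k' on are empty. *)
Definition quant_mx : 'M[R]_(N, d) := \matrix_(c, j)
  \sum_i ((w i == c) && ((dec j).1 == i.1 :> nat))%:R * val ((dec j).2 i.2).

Definition coef (x : 'cV[R]_d) (i : 'I_k' * 'I_L) : R :=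
  \sum_(j | (dec j).1 == i.1 :> nat) val ((dec j).2 i.2) * x j 0.

Lemma mulmx_quant x c :
  (quant_mx *m x) c 0 = \sum_i (w i == c)%:R * coef x i.
Proof.
rewrite mxE; under eq_bigr do rewrite mxE mulr_suml.
rewrite exchange_big; apply: eq_bigr => i _ /=.
rewrite /coef mulr_sumr [RHS]big_mkcond; apply: eq_bigr => j _.
by case: (w i == c); case: eqP => _ /=; rewrite ?mul0r ?mulr0 ?mul1r.
Qed.

Lemma dot_quant x (v : 'cV[R]_N) :
  \sum_c (quant_mx *m x) c 0 * v c 0 = \sum_i coef x i * v (w i) 0.
Proof.
under eq_bigr do rewrite mulmx_quant mulr_suml.
rewrite exchange_big; apply: eq_bigr => i _ /=.
rewrite (bigD1 (w i))//= eqxx mul1r big1 ?addr0// => c.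
by rewrite eq_sym => /negbTE ->; rewrite !mul0r.
Qed.

Lemma sqn_quant x : injective w ->
  sqn (quant_mx *m x) = \sum_i coef x i ^+ 2.
Proof.
move=> winj; transitivity (\sum_c (quant_mx *m x) c 0 * (quant_mx *m x) c 0).
  by apply: eq_bigr => c _; rewrite expr2.
rewrite dot_quant; apply: eq_bigr => i _; rewrite mulmx_quant expr2.
congr (_ * _); rewrite (bigD1 i)//= eqxx mul1r big1 ?addr0// => i' i'i.
by rewrite (inj_eq winj) (negbTE i'i) mul0r.
Qed.

Lemma coef_selector (enc : 'I_k -> 'I_d) (i : 'I_k' * 'I_L) (i0 : 'I_k) :
  cancel enc (fun j => (dec j).1) -> i0 = i.1 :> nat ->
  coef (selector (fun j => (dec j).1) enc) i = val ((dec (enc i0)).2 i.2).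
Proof.
move=> encK ii0; rewrite /coef.
transitivity (\sum_(j | (dec j).1 == i0) val ((dec j).2 i.2) *
    selector (fun j => (dec j).1) enc j 0).
  by apply: eq_bigl => j; rewrite -ii0.
by rewrite (sum_selector (fun j => val ((dec j).2 i.2)) i0 encK).
Qed.

End QuantMatrix.

End Blocks.

(** * Designs that fit a typical vector almost exactly *)

Section Compressible.
Context {R : realType}.

(* If all residuals were small, x would fit both b and its reflection b', but
   |y - b|^2 + |y - b'|^2 >= 2 |b|^2 - 2 |P b|^2 for every y, and P, the
   projection onto the row space of the sketch, has rank at most m. *)
Lemma compressible_lower_bound (n' n3 d k m : nat) (eps p eta : R)
    (D : probability (borel_mx R m (n' + n3)) R) (E : estimator R m d)
    (Z : 'M[R]_(n', d)) (bad0 : set (borel_mx R n' 1)) :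
  (0 < n')%N -> 0 < eps -> eps < 1 -> 0 < eta -> 8 * eta <= p - 2^-1 ->
  oblivious_linear_sketch k eps p D E ->
  measurable bad0 -> gprob bad0 <= eta ->
  (forall b : 'cV[R]_n', ~ bad0 b ->
     exists2 x, sparse k x & sqn (Z *m x - b) <= eta ^+ 2 / 64 * n'%:R) ->
  (eta / 2) ^+ 2 / 8 * eta / 65 * n'%:R < m%:R.
Proof.
move=> n'0 e0 e1 eta0 etap obl mbad0 bad0_le hZ.
have n'0R : 0 < n'%:R :> R by rewrite ltr0n.
rewrite ltNge; apply/negP => mle.
(* With this q, 2q - 1 = p - 1/2 >= 8 eta, which exceeds the total 4 eta of the four bad events. The
   choice a = eta/2 gives [small_bad] probability at most eta, and outside it |b|^2 >= a^2 n'/2. The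
   threshold [lambda] is a quarter of that, and [mle] is what Markov needs to give [proj_bad]
   probability at most eta. *)
pose q := (p + 2^-1) / 2; pose a := eta / 2; pose lambda := a ^+ 2 / 8 * n'%:R.
have a0 : 0 <= a by rewrite /a; lra.
have lambda0 : 0 < lambda.
  by rewrite /lambda mulr_gt0// divr_gt0// exprn_gt0// /a divr_gt0.
have q2 : 2^-1 <= q by rewrite /q; lra.
have qp : q < p by rewrite /q; lra.
have := collision (fun _ : unit => col_mx Z 0 : 'M[R]_(n' + n3, d))
  (col_mx 1%:M 0 : 'M[R]_(n' + n3, n')) 0 q2 qp obl.
move=> [U [gU]]; have gr := gauss_isometry_reflection m gU.
pose small_bad : set (borel_mx R n' 1) :=
  [set v | #|'I_n'|%:R / 2 < \sum_i small a ((v : 'cV[R]_n') i 0)].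
pose proj_bad : set (borel_mx R n' 1) :=
  [set v | lambda < sqn (lowproj m U *m (v : 'cV[R]_n'))].
pose bad0' : set (borel_mx R n' 1) :=
  [set v | bad0 (reflection m U *m (v : 'cV[R]_n'))].
have msmall : measurable small_bad.
  by apply: measurable_ltr; apply: measurable_coord_sum; exact: measurable_small.
have mproj : measurable proj_bad.
  by apply: measurable_ltr; apply: measurable_mulmx_comp; exact: measurable_sqn.
have mbad0' : measurable bad0' by exact: measurable_mulmx_preimage.
pose bad := (bad0 `|` bad0') `|` (small_bad `|` proj_bad).
move=> /(_ (fun=> bad)) [].
- by move=> _; apply: measurableU; exact: measurableU.
- rewrite (big_pred1 tt); last by case.
  rewrite card_unit mulr1 -/(gprob bad).
  have h1 := gprobU (measurableU _ _ mbad0 mbad0') (measurableU _ _ msmall mproj).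
  have h2 := gprobU mbad0 mbad0'; have h3 := gprobU msmall mproj.
  have h4 : gprob bad0' = gprob bad0 by exact: gprob_isometry.
  have h5 : gprob small_bad <= 2 * a by apply: gprob_small; rewrite ?card_ord.
  have h6 : gprob proj_bad <= eta.
    have : lambda * gprob proj_bad <= m%:R * 65.
      apply: gprob_markov; last exact: integral_sqn_lowproj.
      - exact: (measurable_mulmx_comp (lowproj m U) (@measurable_sqn R n')).
      - by move=> v; exact: sqn_ge0.
      - exact: ltW.
    move=> h; rewrite -(ler_pM2l lambda0) (le_trans h)//.
    move: mle; rewrite /lambda /a.
    have -> : (eta / 2) ^+ 2 / 8 * n'%:R * eta = 65 * ((eta / 2) ^+ 2 / 8 * eta / 65 * n'%:R).
      by field.
    lra.
  move: h1 h2 h3 h4 h5 h6; rewrite /bad /q /a; lra.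
move=> _ [b [x [nbad sx]]] hb hb'.
have [nb0 nb0'] : ~ bad0 b /\ ~ bad0' b by split => h; apply: nbad; left; [left|right].
have [nsm nproj] : ~ small_bad b /\ ~ proj_bad b.
  by split => h; apply: nbad; right; [left|right].
have resE (y : 'cV[R]_d) (v : 'cV[R]_n') :
    (col_mx Z 0 : 'M[R]_(n' + n3, d)) *m y - (col_mx 1%:M 0 *m v + 0) =
    col_mx (Z *m y - v) 0.
  by rewrite !mul_col_mx mul1mx !mul0mx addr0 opp_col_mx add_col_mx subr0.
have fin (v : 'cV[R]_n') : ~ bad0 v ->
    l2norm ((col_mx Z 0 : 'M[R]_(n' + n3, d)) *m x - (col_mx 1%:M 0 *m v + 0)) <=
      (1 + eps) * sparse_opt k (col_mx Z 0 : 'M[R]_(n' + n3, d)) (col_mx 1%:M 0 *m v + 0) ->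
    sqn (Z *m x - v) <= 4 * (eta ^+ 2 / 64 * n'%:R).
  move=> /hZ[x0 sx0 hx0] hv.
  have := success_sqn (ltW e0) sx0 _ hv; rewrite !resE !sqn_col_mx !sqn0 !addr0.
  move=> /(_ _ hx0) h; apply: (le_trans h); rewrite ler_wpM2r//.
    by rewrite mulr_ge0 ?ler0n// divr_ge0// sqr_ge0.
  by move: e0 e1; clear; nra.
have {fin} [f1 f2] := (fin _ nb0 hb, fin _ nb0' hb').
(* Nonnegativity of |y - P b|^2 absorbs the cross term. With T = eta^2 n', the two residuals then
   total at least 2 |b|^2 - 2 |P b|^2 >= T/4 - T/16, while success allows only T/8. *)
have hP := sqn_ge0 (Z *m x - lowproj m U *m b); rewrite sqnB in hP.
have := parallelogram_reflection m b (Z *m x) gU; move: hP.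
have := sqn_lb a0 nsm.
have : sqn (lowproj m U *m b) <= lambda by move/negP: nproj; rewrite -leNgt.
have : 0 < eta ^+ 2 * n'%:R by rewrite mulr_gt0// exprn_gt0.
move: f1 f2; rewrite /lambda /a expr_div_n.
set S := \sum_i _; set T := eta ^+ 2 * n'%:R.
have -> : eta ^+ 2 / 64 * n'%:R = T / 64 by rewrite /T; field.
have -> : eta ^+ 2 / 2 ^+ 2 / 8 * n'%:R = T / 32 by rewrite /T; field.
have -> : eta ^+ 2 / 2 ^+ 2 * (n'%:R / 2) = T / 8 by rewrite /T; field.
lra.
Qed.

End Compressible.

(** * Shifted sign vectors with forcing rows *)

Section SignDesign.
Context {R : realType}.

(* The sign vectors live on r = k' * L coordinates shifted by t; a sketch of
   rank m captures only a fraction m / N.+1 of them for an average t. *)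
Definition window N k' L (hr : (k' * L <= N.+1)%N) (t : 'I_N.+1)
    (i : 'I_k' * 'I_L) : 'I_N.+1 :=
  widen_ord hr (mxvec_index i.1 i.2) + t.

Lemma window_inj N k' L (hr : (k' * L <= N.+1)%N) t : injective (window hr t).
Proof.
by move=> [i l] [i' l'] /addIr /(congr1 val) /= /ord_inj /enum_rank_inj.
Qed.

Lemma sum_window N k' L (hr : (k' * L <= N.+1)%N) (f : 'I_N.+1 -> R) :
  \sum_t \sum_i f (window hr t i) = (k' * L)%:R * \sum_c f c.
Proof.
rewrite exchange_big /=.
transitivity (\sum_(i : 'I_k' * 'I_L) \sum_c f c).
  apply: eq_bigr => i _; rewrite [RHS](reindex_inj (addrI (widen_ord hr (mxvec_index i.1 i.2)))).
  by [].
by rewrite sumr_const card_prod !card_ord mulr_natl.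
Qed.

Lemma gprob_markov_sum n (I : finType) (f : I -> borel_mx R n 1 -> R) (lambda K : R) :
  (forall i, measurable_fun setT (f i)) -> (forall i x, 0 <= f i x) -> 0 <= lambda ->
  (\int[gaussvec n]_v (\sum_i f i v)%R%:E <= K%:E)%E ->
  lambda * \sum_i gprob [set v | lambda < f i v] <= K.
Proof.
move=> mf f0 l0 fK; rewrite -lee_fin; apply: le_trans fK.
under eq_integral do rewrite -sumEFin.
rewrite ge0_integral_sum//; last 2 first.
- by move=> i; exact/measurable_EFinP.
- by move=> i x _; rewrite lee_fin.
rewrite mulr_sumr -sumEFin; apply: lee_sum => i _.
rewrite EFinM -gprobE; last exact: measurable_ltr.
exact: markov_ineq.
Qed.

(** Cauchy-Schwarz, through |f| <= (f^2/s + s)/2 in each term. *)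
Lemma sum_abs_ub (I : finType) (f : I -> R) (s : R) : 0 < s ->
  \sum_i f i ^+ 2 <= #|I|%:R * s ^+ 2 -> \sum_i `|f i| <= #|I|%:R * s.
Proof.
move=> s0 h; have : \sum_i `|f i| <= \sum_i (f i ^+ 2 / s + s) / 2.
  apply: ler_sum => i _; rewrite ler_pdivlMr//.
  rewrite -(ler_pM2r s0) mulrDl divfK ?gt_eqF// -[f i ^+ 2]real_normK ?num_real//.
  have := sqr_ge0 (`|f i| - s); rewrite sqrrB; lra.
move=> /le_trans; apply; rewrite -mulr_suml big_split /= -mulr_suml sumr_const.
rewrite ler_pdivrMr//.
have -> : #|I|%:R * s * 2 = #|I|%:R * s + s *+ #|I| by rewrite -mulr_natl; ring.
by rewrite lerD2r ler_pdivrMr// -mulrA -expr2.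
Qed.

Definition sgnval (tau : R) (b : bool) : R := if b then - tau else tau.

Lemma sgnval_sqr tau b : sgnval tau b ^+ 2 = tau ^+ 2.
Proof. by case: b; rewrite /sgnval ?sqrrN. Qed.

Lemma sgnval_abs tau (x : R) : sgnval tau (x < 0) * x = tau * `|x|.
Proof.
rewrite /sgnval; case: ltP => x0; first by rewrite ltr0_norm// mulNr mulrN.
by rewrite ger0_norm.
Qed.

Section Forcing.
(* The rows scaled by M force every block sum to be close to 1, so that a sparse
   answer selects exactly one sign vector in each block. *)
Variables (N k k' L d n3 : nat) (hk : (k' <= k)%N) (hr : (k' * L <= N.+1)%N).
Variables (dec : 'I_d -> 'I_k * {ffun 'I_L -> bool}) (tau M : R).

Definition block_mx1 : 'M[R]_(k, d) := \matrix_(i, j) ((dec j).1 == i)%:R.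

Definition design (t : 'I_N.+1) : 'M[R]_(N.+1 + k + n3, d) :=
  col_mx (col_mx (quant_mx (window hr t) (sgnval tau) dec) (M *: block_mx1)) 0.

Definition embed : 'M[R]_(N.+1 + k + n3, N.+1) := col_mx (col_mx 1%:M 0) 0.

Definition target : 'cV[R]_(N.+1 + k + n3) := col_mx (col_mx 0 (const_mx M)) 0.

Definition block_sum (x : 'cV[R]_d) (i : 'I_k) : R := \sum_(j | (dec j).1 == i) x j 0.

Lemma sqn_residual (t : 'I_N.+1) (x : 'cV[R]_d) (v : 'cV[R]_N.+1) :
  sqn (design t *m x - (embed *m v + target)) =
  sqn (quant_mx (window hr t) (sgnval tau) dec *m x - v) +
  M ^+ 2 * \sum_i (block_sum x i - 1) ^+ 2.
Proof.
rewrite /design /embed /target !mul_col_mx !mul0mx mul1mx !add_col_mx !addr0.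
rewrite !opp_col_mx !add_col_mx !sqn_col_mx subr0 sqn0 addr0 add0r; congr (_ + _).
rewrite /sqn mulr_sumr; apply: eq_bigr => i _.
rewrite -scalemxAl !mxE -exprMn; congr (_ ^+ 2); rewrite mulrBr mulr1.
congr (_ * _ - _); rewrite /block_sum [RHS]big_mkcond; apply: eq_bigr => j _.
by rewrite mxE; case: eqP => _; rewrite ?mul1r ?mul0r.
Qed.

Lemma sqn_quantB (t : 'I_N.+1) (x : 'cV[R]_d) (v : 'cV[R]_N.+1) :
  sqn (quant_mx (window hr t) (sgnval tau) dec *m x - v) =
  sqn v + \sum_(i : 'I_k' * 'I_L) coef (sgnval tau) dec x i ^+ 2
  - 2 * \sum_i coef (sgnval tau) dec x i * v (window hr t i) 0.
Proof.
by rewrite sqnB (dot_quant (window hr t)) sqn_quant ?(addrC (sqn v))//; exact: window_inj.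
Qed.

(** Blocks from k' on have no window coordinates and need a single column each; their forced sums
    still consume sparsity, so that all k nonzeros are accounted for. *)
Hypothesis decP : forall (i : 'I_k) (s : {ffun 'I_L -> bool}), (i < k')%N || (s == [ffun=> false]) ->
  exists j, dec j = (i, s).

(** The witness copies the signs of v on the window, which turns the inner product into tau times an
    l1 norm. It takes one column with coefficient 1 in every block, so the forcing rows contribute
    nothing. *)
Lemma sign_choice (t : 'I_N.+1) (v : 'cV[R]_N.+1) :
  exists2 x, sparse k x &
    sqn (design t *m x - (embed *m v + target)) =
    sqn v + tau ^+ 2 * (k' * L)%:R
      - 2 * (tau * \sum_i `|v (window hr t i) 0|).
Proof.
pose sg (i : 'I_k) : {ffun 'I_L -> bool} :=
  if insub (val i) is Some i' then [ffun l => v (window hr t (i', l)) 0 < 0]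
  else [ffun=> false].
have /choice[enc henc] : forall i, exists j, dec j = (i, sg i).
  move=> i; apply: decP; rewrite /sg; case: insubP => [i' -> _|]//.
  by rewrite eqxx orbT.
have encK : cancel enc (fun j => (dec j).1) by move=> i; rewrite henc.
exists (selector (fun j => (dec j).1) enc); first exact: sparse_selector.
rewrite sqn_residual sqn_quantB [X in M ^+ 2 * X]big1 ?mulr0 ?addr0; last first.
  move=> i _; rewrite /block_sum.
  under eq_bigr do rewrite -[selector _ _ _ _]mul1r.
  by rewrite (sum_selector (fun=> 1) i encK) subrr expr0n.
have cE (i : 'I_k' * 'I_L) : coef (sgnval tau) dec (selector (fun j => (dec j).1) enc) i =
    sgnval tau (v (window hr t i) 0 < 0).
  rewrite (@coef_selector _ _ _ _ _ _ _ _ _ _ (widen_ord hk i.1))//.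
  rewrite henc /sg /=; case: insubP => [i' _ i'E|]; last by rewrite ltn_ord.
  rewrite ffunE (_ : i' = i.1); last exact: val_inj.
  by case: i {i'E}.
congr (_ + _ - 2 * _).
  under eq_bigr do rewrite cE sgnval_sqr.
  by rewrite sumr_const card_prod !card_ord mulr_natr.
by rewrite mulr_sumr; apply: eq_bigr => i _; rewrite cE sgnval_abs.
Qed.

(** Nonzero block sums leave a sparse x one column per block, so on each block y is a multiple of a
    single sign vector. *)
Lemma coef_block (x : 'cV[R]_d) : sparse k x -> (forall i, block_sum x i != 0) ->
  forall i : 'I_k' * 'I_L,
    exists b, coef (sgnval tau) dec x i = sgnval tau b * block_sum x (widen_ord hk i.1).
Proof.
move=> sx bx i; set i0 := widen_ord hk i.1.
have [j [ji jx]] := sparse_block sx bx i0.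
exists ((dec j).2 i.2); rewrite /coef /block_sum.
rewrite (bigD1 j) ?ji//= big1 ?addr0; last first.
  by move=> j' /andP[/eqP ij' jj']; rewrite jx ?mulr0//; exact: val_inj.
by rewrite [in RHS](bigD1 j) ?ji//= big1 ?addr0// => j' /andP[/eqP ij' jj']; rewrite jx.
Qed.

End Forcing.

End SignDesign.

(** * Lower bounds on the number of rows *)

Section WindowBound.
Context {R : realType}.

(* B = |b|^2, S2 = |y|^2 and SP = <y, P b> for the common answer y, while beta
   and beta' are the correlations that the best sign vectors achieve with b and
   with its reflection. *)
Lemma window_contradiction (eps N r tau c1 C B S2 SP beta beta' F F' : R) :
  0 < eps -> eps < 1 -> 0 < N -> 0 < r -> 0 < c1 -> 0 < tau ->
  tau ^+ 2 * r = N -> (6 * C + 10) ^+ 2 * (eps ^+ 2 * N) <= c1 ^+ 2 * r ->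
  0 <= C -> B <= C * N -> 0 <= B ->
  c1 * r <= beta -> c1 * r <= beta' ->
  (1 - eps) ^+ 2 * N <= S2 -> SP <= (1 + eps) * tau * (r * (c1 / 8)) ->
  F + F' = 2 * B + 2 * S2 - 4 * SP ->
  0 <= B + N - 2 * (tau * beta) -> 0 <= B + N - 2 * (tau * beta') ->
  F <= (1 + eps) ^+ 2 * (B + N - 2 * (tau * beta)) ->
  F' <= (1 + eps) ^+ 2 * (B + N - 2 * (tau * beta')) -> False.
Proof.
move=> e0 e1 N0 r0 c0 t0 tN hN C0 BC B0 hb hb' hS hP FF V0 V0' hF hF'.
have e2 : (1 + eps) ^+ 2 <= 1 + 3 * eps by nra.
have W V : 0 <= V -> (1 + eps) ^+ 2 * V <= (1 + 3 * eps) * V.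
  by move=> ?; rewrite ler_wpM2r.
have {}hF := le_trans hF (W _ V0); have {}hF' := le_trans hF' (W _ V0').
have tb : tau * (c1 * r) <= tau * beta by rewrite ler_pM2l.
have tb' : tau * (c1 * r) <= tau * beta' by rewrite ler_pM2l.
set x := tau * (c1 * r) in tb tb'.
have x0 : 0 < x by rewrite !mulr_gt0.
have hP' : SP <= x / 4.
  apply: (le_trans hP); have -> : (1 + eps) * tau * (r * (c1 / 8)) = (1 + eps) * x / 8.
    by rewrite /x; field.
  nra.
have hS' : N - 2 * eps * N <= S2.
  apply: le_trans hS; nra.
(* The success bounds give F + F' <= 2 (1 + 3 eps) (B + N) - 4x, and the parallelogram identity
   gives F + F' >= 2B + 2N - 4 eps N - x. The difference is 3x <= 6 eps (B + N) + 4 eps N, whence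
   the constant 6C + 10. By hypothesis the square of the right-hand side is at most x^2. *)
have key : 3 * x <= (6 * C + 10) * (eps * N).
  have Eb : (1 + 3 * eps) * (B + N - 2 * (tau * beta)) <= (1 + 3 * eps) * (B + N) - 2 * x.
    nra.
  have Eb' : (1 + 3 * eps) * (B + N - 2 * (tau * beta')) <= (1 + 3 * eps) * (B + N) - 2 * x.
    nra.
  have : eps * B <= eps * (C * N) by rewrite ler_pM2l.
  nra.
have sq : (3 * x) ^+ 2 <= ((6 * C + 10) * (eps * N)) ^+ 2.
  rewrite lerXn2r// nnegrE; first lra.
  by rewrite !mulr_ge0// ?(ltW e0) ?(ltW N0)//; lra.
have xE : x ^+ 2 = c1 ^+ 2 * (N * r).
  by rewrite -tN /x; ring.
have : 9 * (c1 ^+ 2 * r) * N <= (c1 ^+ 2 * r) * N.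
  apply: le_trans (_ : (6 * C + 10) ^+ 2 * (eps ^+ 2 * N) * N <= _).
    have -> : 9 * (c1 ^+ 2 * r) * N = (3 * x) ^+ 2 by rewrite [RHS]exprMn xE; ring.
    apply: (le_trans sq); rewrite le_eqVlt; apply/orP; left; apply/eqP; ring.
  by rewrite ler_pM2r.
rewrite ler_pM2r//; have : 0 < c1 ^+ 2 * r by rewrite mulr_gt0// exprn_gt0.
lra.
Qed.

Lemma card_sign_blocks (k k' L : nat) : (k' <= k)%N ->
  (#|[pred is_ : 'I_k * {ffun 'I_L -> bool} |
      (is_.1 < k')%N || (is_.2 == [ffun=> false])]| <= k' * 2 ^ L + (k - k'))%N.
Proof.
move=> hk; pose A := [set i : 'I_k | (i < k')%N]%SET.
have winj : injective (widen_ord hk) by move=> i j /(congr1 val) /= /ord_inj.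
have cA : #|A| = k'.
  rewrite -[RHS]card_ord -(card_imset _ winj).
  apply: eq_card => i; rewrite inE; apply/idP/imsetP => [ik|[j _ ->]].
    by exists (Ordinal ik) => //; exact: val_inj.
  exact: (ltn_ord j).
apply: (@leq_trans #|finset.setU (finset.setX A [set: {ffun 'I_L -> bool}]%SET)
   (finset.setX (finset.setC A) [set [ffun=> false]]%SET)|).
  apply: subset_leq_card; apply/fintype.subsetP => -[i s]; rewrite !inE /=.
  by case: ltnP.
rewrite (leq_trans (leq_card_setU _ _))// !cardsX cA cards1 muln1 cardsT.
by rewrite card_ffun card_bool card_ord cardsCs finset.setCK cA card_ord.
Qed.

End WindowBound.

Section WindowBound.
Context {R : realType}.

Lemma window_lower_bound (N k k' L d n3 m : nat) (eps p eta : R)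
    (D : probability (borel_mx R m (N.+1 + k + n3)) R) (E : estimator R m d) :
  (k' <= k)%N -> (0 < k' * L)%N -> (k' * L <= N.+1)%N ->
  (k' * 2 ^ L + (k - k') <= d)%N ->
  0 < eps -> eps < 1 -> 0 < eta -> 8 * eta <= p - 2^-1 ->
  (6 * (65 / eta) + 10) ^+ 2 * (eps ^+ 2 * N.+1%:R) <= (eta / 4) ^+ 2 * (k' * L)%:R ->
  oblivious_linear_sketch k eps p D E ->
  (eta / 32) ^+ 2 * eta / 65 * N.+1%:R < m%:R.
Proof.
move=> hk r0 hr hd e0 e1 eta0 etap heps obl.
have k0 : (0 < k)%N by rewrite (leq_trans _ hk)//; move: r0; rewrite muln_gt0 => /andP[].
have [dec decP'] := exists_decoder (Ordinal k0, [ffun=> false])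
  (leq_trans (card_sign_blocks L hk) hd).
have decP (i : 'I_k) (s : {ffun 'I_L -> bool}) :
  (i < k')%N || (s == [ffun=> false]) -> exists j, dec j = (i, s).
  by move=> h; apply: decP'.
have N0 : 0 < N.+1%:R :> R by rewrite ltr0n.
have r0R : 0 < (k' * L)%:R :> R by rewrite ltr0n.
set r : R := (k' * L)%:R in heps r0R.
have cX : #|{: 'I_k' * 'I_L}| = (k' * L)%N by rewrite card_prod !card_ord.
(* Each constant makes a bad event have probability at most eta: a for many small window
   coordinates, C for a large |b|^2. Since at least half of the window exceeds a in absolute value
   otherwise, the l1 norm there is at least c1 r with c1 = a/2. *)
pose a := eta / 2; pose c1 := eta / 4; pose C := 65 / eta.
have a0 : 0 <= a by rewrite /a; lra.
have c10 : 0 < c1 by rewrite /c1; lra.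
have C0 : 0 < C by rewrite /C divr_gt0.
pose tau := Num.sqrt (N.+1%:R / r : R).
have tau0 : 0 < tau by rewrite sqrtr_gt0 divr_gt0.
have tauN : tau ^+ 2 * r = N.+1%:R.
  by rewrite sqr_sqrtr ?divfK ?gt_eqF// divr_ge0// ltW.
(* V bounds the residual of the best sign vector for a typical b. A (1 + eps)-optimal answer thus
   has residual at most 4V, and M is chosen so that the squared errors of its block sums total at
   most 4V / M^2 = eps^2. *)
pose V := (C + 1) * N.+1%:R; pose M := 2 * Num.sqrt V / eps.
have V0 : 0 < V by rewrite mulr_gt0//; lra.
have M2 : M ^+ 2 * eps ^+ 2 = 4 * V.
  rewrite -exprMn /M divfK ?gt_eqF// exprMn sqr_sqrtr ?(ltW V0)//; ring.
rewrite ltNge; apply/negP => mle.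
pose q := (p + 2^-1) / 2.
have q2 : 2^-1 <= q by rewrite /q; lra.
have qp : q < p by rewrite /q; lra.
have [U [gU]] := collision (design n3 hr dec tau M) (embed N k n3)
  (target N k n3 M) q2 qp obl.
have gr := gauss_isometry_reflection m gU.
pose lambda := r * (c1 / 8) ^+ 2.
have lambda0 : 0 < lambda by rewrite mulr_gt0// exprn_gt0// divr_gt0.
pose w := window hr.
pose big_bad : set (borel_mx R N.+1 1) :=
  [set v | C * N.+1%:R < sqn (v : 'cV[R]_N.+1)].
pose small_bad t : set (borel_mx R N.+1 1) :=
  [set v | #|{: 'I_k' * 'I_L}|%:R / 2 < \sum_i small a ((v : 'cV[R]_N.+1) (w t i) 0)].
pose small_bad' t : set (borel_mx R N.+1 1) :=
  [set v | small_bad t (reflection m U *m (v : 'cV[R]_N.+1))].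
pose projsum t (v : borel_mx R N.+1 1) : R :=
  \sum_i (lowproj m U *m (v : 'cV[R]_N.+1)) (w t i) 0 ^+ 2.
pose proj_bad t : set (borel_mx R N.+1 1) := [set v | lambda < projsum t v].
have mbig : measurable big_bad by apply: measurable_ltr; exact: measurable_sqn.
have msmall t : measurable (small_bad t).
  by apply: measurable_ltr; apply: measurable_coord_sum; exact: measurable_small.
have msmall' t : measurable (small_bad' t) by exact: measurable_mulmx_preimage.
have mprojsum t : measurable_fun setT (projsum t).
  have mg : measurable_fun setT (fun x : R => x ^+ 2) by exact: measurable_funX.
  exact: (measurable_mulmx_comp (lowproj m U) (measurable_coord_sum _ (w t) mg)).
have mproj t : measurable (proj_bad t) by exact: measurable_ltr.
pose bad t := (big_bad `|` small_bad t) `|` (small_bad' t `|` proj_bad t).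
move=> /(_ bad) [].
- by move=> t; apply: measurableU; exact: measurableU.
- have h1 : gprob big_bad <= eta.
    have : C * N.+1%:R * gprob big_bad <= N.+1%:R * 65.
      by apply: gprob_sqn; rewrite mulr_ge0// ltW.
    have -> : N.+1%:R * 65 = C * N.+1%:R * eta :> R by rewrite /C; field; rewrite gt_eqF.
    by rewrite ler_pM2l// mulr_gt0.
  have h2 t : gprob (small_bad t) <= eta.
    have -> : eta = 2 * a by rewrite /a; field.
    by apply: gprob_small; rewrite ?cX.
  have h2' t : gprob (small_bad' t) <= eta by rewrite gprob_isometry.
  (* As t runs over all shifts, each coordinate is covered r times, so the window energies of P b
     add up to r |P b|^2, of mean at most 65 r m. This is where the assumed upper bound on m
     enters. *)
  have h3 : \sum_t gprob (proj_bad t) <= N.+1%:R * eta.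
    have : lambda * \sum_t gprob (proj_bad t) <= r * (m%:R * 65).
      apply: gprob_markov_sum => //; [|exact: ltW|].
        by move=> t v; apply: sumr_ge0 => i _; exact: sqr_ge0.
      rewrite /projsum; under eq_integral => v _.
        rewrite (sum_window hr (fun c => (lowproj m U *m (v : 'cV[R]_N.+1)) c 0 ^+ 2)).
        rewrite EFinM; over.
      rewrite ge0_integralZl//=; last 2 first.
      + apply/measurable_EFinP.
        exact: (measurable_mulmx_comp (lowproj m U) (@measurable_sqn R N.+1)).
      + by move=> v _; rewrite lee_fin; exact: sqn_ge0.
      rewrite EFinM lee_wpmul2l// ?lee_fin ?ler0n//.
      exact: integral_sqn_lowproj.
    move=> h; rewrite -(ler_pM2l lambda0) (le_trans h)//.
    rewrite /lambda -mulrA ler_pM2l//.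
    have -> : (c1 / 8) ^+ 2 * (N.+1%:R * eta) = ((eta / 32) ^+ 2 * eta / 65 * N.+1%:R) * 65.
      by rewrite /c1; field.
    by rewrite ler_wpM2r.
  rewrite -/(gprob _).
  apply: (@le_lt_trans _ _ (\sum_t (eta + eta + eta + gprob (proj_bad t)))).
    apply: ler_sum => t _.
    have u1 := gprobU (measurableU _ _ mbig (msmall t)) (measurableU _ _ (msmall' t) (mproj t)).
    have u2 := gprobU mbig (msmall t); have u3 := gprobU (msmall' t) (mproj t).
    apply: (le_trans u1); apply: (le_trans (lerD u2 u3)); rewrite addrA.
    by rewrite lerD2r; apply: lerD => //; exact: lerD.
  rewrite big_split /= sumr_const card_ord -mulr_natl.
  apply: (@le_lt_trans _ _ (N.+1%:R * (4 * eta))); first lra.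
  by rewrite mulrC ltr_pM2r// /q; lra.
move=> t [b [x [nbad sx hb hb']]].
set b' := reflection m U *m b in hb'.
have nbig : ~ big_bad b by move=> h; apply: nbad; left; left.
have nsmall : ~ small_bad t b by move=> h; apply: nbad; left; right.
have nsmall' : ~ small_bad t b' by move=> h; apply: nbad; right; left.
have nproj : ~ proj_bad t b by move=> h; apply: nbad; right; right.
have Bb' : sqn b' = sqn b by rewrite (sqn_isometry b gr.1).
have Bb : sqn b <= C * N.+1%:R by move/negP: nbig; rewrite -leNgt.
pose beta (v : 'cV[R]_N.+1) := \sum_i `|v (w t i) 0|.
have hbeta (v : 'cV[R]_N.+1) : ~ small_bad t v -> c1 * r <= beta v.
  move=> h; have := sum_abs_lb a0 h; rewrite cX.
  by have -> : a * ((k' * L)%:R / 2) = c1 * r by rewrite /a /c1; field.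
have beta_pos (v : 'cV[R]_N.+1) : 0 <= tau * beta v.
  by rewrite mulr_ge0 ?(ltW tau0)// sumr_ge0.
have [x0 sx0 hx0] := sign_choice n3 hk hr tau M decP t b.
have [x1 sx1 hx1] := sign_choice n3 hk hr tau M decP t b'.
rewrite -/r tauN -/(beta _) in hx0; rewrite -/r tauN Bb' -/(beta _) in hx1.
have {hb} := success_sqn (ltW e0) sx0 (lexx _) hb.
have {hb'} := success_sqn (ltW e0) sx1 (lexx _) hb'.
have := sqn_ge0 (design n3 hr dec tau M t *m x0 - (embed N k n3 *m b + target N k n3 M)).
have := sqn_ge0 (design n3 hr dec tau M t *m x1 - (embed N k n3 *m b' + target N k n3 M)).
rewrite hx0 hx1 !sqn_residual.
set Z := quant_mx _ _ _; set T := \sum_i (block_sum dec x i - 1) ^+ 2.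
move=> V1 V2 hb' hb.
have T0 : 0 <= M ^+ 2 * T by rewrite mulr_ge0 ?sqr_ge0// sumr_ge0// => i _; exact: sqr_ge0.
have e2 : (1 + eps) ^+ 2 <= 4 by move: e0 e1; clear; nra.
have TV : M ^+ 2 * T <= M ^+ 2 * eps ^+ 2.
  rewrite M2; have VV : sqn b + N.+1%:R - 2 * (tau * beta b) <= V.
    by rewrite /V; move: (beta_pos b) Bb; clear; lra.
  have h : (1 + eps) ^+ 2 * (sqn b + N.+1%:R - 2 * (tau * beta b)) <= 4 * V.
    by apply: ler_pM => //; exact: sqr_ge0.
  by move: (sqn_ge0 (Z *m x - b)) hb h; clear; lra.
have Mp : 0 < M ^+ 2.
  by rewrite exprn_gt0// /M divr_gt0// mulr_gt0// sqrtr_gt0.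
rewrite ler_pM2l// in TV.
have sB i : (block_sum dec x i - 1) ^+ 2 <= eps ^+ 2.
  apply: le_trans TV; rewrite /T (bigD1 i)//= lerDl sumr_ge0// => j _.
  exact: sqr_ge0.
have sB' i : 1 - eps <= block_sum dec x i <= 1 + eps.
  have := sB i; rewrite -[leLHS]real_normK ?num_real// ler_sqr ?nnegrE ?(ltW e0)//.
  by rewrite ler_norml => /andP[h1 h2]; apply/andP; split; move: h1 h2; clear; lra.
have bx i : block_sum dec x i != 0.
  by have /andP[+ _] := sB' i; case: eqP => // ->; move: e1; clear; lra.
have cb := coef_block hk tau sx bx.
pose u := coef (sgnval tau) dec x : 'I_k' * 'I_L -> R.
have u2 : (1 - eps) ^+ 2 * N.+1%:R <= \sum_i u i ^+ 2.
  have -> : (1 - eps) ^+ 2 * N.+1%:R = \sum_(i : 'I_k' * 'I_L) (1 - eps) ^+ 2 * tau ^+ 2.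
    transitivity ((1 - eps) ^+ 2 * tau ^+ 2 * #|{: 'I_k' * 'I_L}|%:R).
      by rewrite cX -mulrA tauN.
    by rewrite sumr_const mulr_natr.
  apply: ler_sum => i _; rewrite /u; have [sb ->] := cb i.
  have /andP[s1 _] := sB' (widen_ord hk i.1).
  have s0 : 0 <= 1 - eps by move: e1; clear; lra.
  rewrite exprMn sgnval_sqr mulrC ler_wpM2l ?sqr_ge0//.
  by rewrite lerXn2r// nnegrE// (le_trans s0).
have uP : \sum_i u i * (lowproj m U *m b) (w t i) 0 <= (1 + eps) * tau * (r * (c1 / 8)).
  have pi_le : \sum_i `|(lowproj m U *m b) (w t i) 0| <= r * (c1 / 8).
    rewrite /r -cX; apply: sum_abs_ub; first by rewrite divr_gt0.
    by rewrite cX leNgt; apply/negP.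
  apply: (@le_trans _ _ (\sum_i (1 + eps) * tau * `|(lowproj m U *m b) (w t i) 0|)).
    apply: ler_sum => il _; apply: (le_trans (ler_norm _)); rewrite normrM.
    rewrite ler_wpM2r//; rewrite /u; have [sb ->] := cb il; rewrite normrM mulrC.
    apply: ler_pM => //.
      have /andP[h1 h2] := sB' (widen_ord hk il.1).
      by rewrite ger0_norm//; move: h1 e1; clear; lra.
    by rewrite /sgnval; case: (sb); rewrite ?normrN gtr0_norm.
  rewrite -mulr_sumr ler_wpM2l// mulr_ge0// ?(ltW tau0)//; move: e0; clear; lra.
apply: (@window_contradiction R eps N.+1%:R r tau c1 C (sqn b) (\sum_i u i ^+ 2)
  (\sum_i u i * (lowproj m U *m b) (w t i) 0) (beta b) (beta b')
  (sqn (Z *m x - b)) (sqn (Z *m x - b'))) => //.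
- exact: ltW.
- exact: sqn_ge0.
- exact: hbeta.
- exact: hbeta.
- rewrite parallelogram_reflection// (dot_quant (window hr t)) sqn_quant//.
  exact: window_inj.
- by apply: le_trans hb; rewrite lerDl.
- by apply: le_trans hb'; rewrite lerDl.
Qed.

End WindowBound.

(** * Grid-valued and identity designs *)

Section Grid.
Context {R : realType}.
Local Notation gauss := (normal_prob (0 : R) 1).

(** The multiples of 1/N from -N to N. *)
Definition grid (N : nat) (s : 'I_(2 * N ^ 2).+1) : R :=
  (s%:R - N%:R ^+ 2) / N%:R.

(** Within [-N, N], rounding down errs by at most 1/N; outside, the value 0 has squared error x^2 <=
    x^4 / N^2. The fourth moment then controls the mean error. *)
Lemma grid_approx (N : nat) (x : R) : (0 < N)%N ->
  exists s : 'I_(2 * N ^ 2).+1, (grid s - x) ^+ 2 <= (1 + x ^+ 4) / N%:R ^+ 2.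
Proof.
move=> N0; have N0R : 0 < N%:R :> R by rewrite ltr0n.
have N2 : 0 < N%:R ^+ 2 :> R by rewrite exprn_gt0.
have [xN|xN] := leP `|x| N%:R.
  have /andP[x1 x2] : - N%:R <= x <= N%:R by rewrite -ler_norml.
  pose y := (x + N%:R) * N%:R; have y0 : 0 <= y by rewrite mulr_ge0// ?ler0n//; lra.
  have /andP[t1 t2] := truncn_itv y0.
  have tN : (Num.truncn y < (2 * N ^ 2).+1)%N.
    rewrite ltnS -(ler_nat R) (le_trans t1)// /y natrM natrX expr2 mulrA ler_pM2r//; lra.
  exists (Ordinal tN); rewrite /grid /=; set s : R := _%:R in t1 *.
  rewrite -natr1 -/s in t2.
  have -> : (s - N%:R ^+ 2) / N%:R - x = (s - y) / N%:R.
    by rewrite /y; field; rewrite gt_eqF.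
  rewrite expr_div_n ler_pM2r ?invr_gt0//.
  have : 0 <= x ^+ 4 by rewrite exprn_even_ge0.
  nra.
have N_lt : (N ^ 2 < (2 * N ^ 2).+1)%N by rewrite ltnS leq_pmull.
exists (Ordinal N_lt); rewrite /grid /= natrX subrr mul0r sub0r sqrrN.
rewrite ler_pdivlMr//; have : N%:R ^+ 2 <= x ^+ 2.
  by rewrite -[leRHS]real_normK ?num_real// lerXn2r ?nnegrE// ?ler0n// ltW.
have -> : x ^+ 4 = x ^+ 2 * x ^+ 2 by ring.
have := sqr_ge0 x; nra.
Qed.

Lemma integral_grid_error (N : nat) : (0 < N)%N ->
  (\int[gauss]_x ((1 + x ^+ 4) / N%:R ^+ 2)%:E <= (65 / N%:R ^+ 2)%:E)%E.
Proof.
move=> N0; have N2 : 0 <= (N%:R ^+ 2)^-1 :> R by rewrite invr_ge0 exprn_ge0.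
have m4 : measurable_fun setT (fun x : R => (x ^+ 4)%:E).
  by apply/measurable_EFinP; exact: measurable_funX.
have p4 (x : R) : (0 <= (x ^+ 4)%:E)%E by rewrite lee_fin exprn_even_ge0.
under eq_integral do rewrite mulrC EFinM EFinD.
rewrite ge0_integralZl//=; last 2 first.
- exact: emeasurable_funD.
- by move=> x _; rewrite adde_ge0.
rewrite ge0_integralD// integral_cst// mulrC EFinM lee_wpmul2l ?lee_fin//.
rewrite [X in (1 * X)%E]probability_setT mule1.
have -> : 65%:E = (1 + 64%:E :> \bar R)%E by rewrite -EFinD; congr EFin; ring.
by rewrite leeD2l// gauss_fourth_moment.
Qed.

(** The columns of a block are all grid-valued vectors, so each coordinate of b can be rounded, at
    mean squared error at most 65 / N^2. By Markov and the size of N the total stays below eta^2/64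
    per coordinate with probability at least 1 - eta. There are no forcing rows, because
    [compressible_lower_bound] copes with every y. *)
Lemma grid_lower_bound (k l d n3 m N : nat) (eps p eta : R)
    (D : probability (borel_mx R m (k * l + n3)) R) (E : estimator R m d) :
  (0 < k * l)%N -> (0 < N)%N -> 64 * 65 <= eta ^+ 3 * N%:R ->
  (k * (2 * N ^ 2).+1 ^ l <= d)%N ->
  0 < eps -> eps < 1 -> 0 < eta -> 8 * eta <= p - 2^-1 ->
  oblivious_linear_sketch k eps p D E ->
  (eta / 2) ^+ 2 / 8 * eta / 65 * (k * l)%:R < m%:R.
Proof.
move=> kl0 N0 etaN hd e0 e1 eta0 etap obl.
have k0 : (0 < k)%N by move: kl0; rewrite muln_gt0 => /andP[].
have N0R : 0 < N%:R :> R by rewrite ltr0n.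
have N2 : 0 < N%:R ^+ 2 :> R by rewrite exprn_gt0.
have kl0R : 0 < (k * l)%:R :> R by rewrite ltr0n.
have Pd : (#|{: 'I_k * {ffun 'I_l -> 'I_(2 * N ^ 2).+1}}| <= d)%N.
  by rewrite card_prod card_ffun !card_ord.
have [dec decP] := exists_decoder (Ordinal k0, [ffun=> ord0]) Pd.
pose w (i : 'I_k * 'I_l) : 'I_(k * l) := mxvec_index i.1 i.2.
have wbij : bijective w.
  apply: inj_card_bij; last by rewrite card_prod !card_ord.
  by move=> [i a] [i' a'] /(congr1 val) /= /ord_inj /enum_rank_inj.
have winj := bij_inj wbij.
pose err (x : R) : R := (1 + x ^+ 4) / N%:R ^+ 2.
have err0 x : 0 <= err x.
  by rewrite divr_ge0 ?(ltW N2)// addr_ge0// exprn_even_ge0.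
have merr : measurable_fun setT err.
  by apply: measurable_funM => //; apply: measurable_funD => //; exact: measurable_funX.
have errK : (\int[gauss]_x (err x)%:E <= (65 / N%:R ^+ 2)%:E)%E.
  exact: integral_grid_error.
pose kappa := eta ^+ 2 / 64 * (k * l)%:R.
have kappa0 : 0 < kappa by rewrite mulr_gt0// divr_gt0// exprn_gt0.
pose bad0 : set (borel_mx R (k * l) 1) :=
  [set v | kappa < \sum_i err ((v : 'cV[R]_(k * l)) (w i) 0)].
apply: (@compressible_lower_bound R (k * l) n3 d k m eps p eta D E
  (quant_mx w (@grid N) dec) bad0) => //.
- by apply: measurable_ltr; exact: measurable_coord_sum.
- have : kappa * gprob bad0 <= #|{: 'I_k * 'I_l}|%:R * (65 / N%:R ^+ 2).
    apply: gprob_markov; [exact: measurable_coord_sum| |exact: ltW|].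
      by move=> v; apply: sumr_ge0.
    exact: integral_gaussvec_sum_le.
  rewrite card_prod !card_ord => h; rewrite -(ler_pM2l kappa0) (le_trans h)//.
  rewrite /kappa mulrA ler_pdivrMr//.
  have -> : eta ^+ 2 / 64 * (k * l)%:R * eta * N%:R ^+ 2 =
    (k * l)%:R * ((eta ^+ 3 * N%:R) / 64 * N%:R) by field.
  rewrite ler_pM2l//.
  have N1 : 1 <= N%:R :> R by rewrite ler1n.
  have : 65 * N%:R <= eta ^+ 3 * N%:R / 64 * N%:R.
    by rewrite ler_pM2r// ler_pdivlMr// mulrC.
  lra.
move=> b nbad.
have /choice[s hs] : forall i, exists t, (@grid N t - b (w i) 0) ^+ 2 <= err (b (w i) 0).
  by move=> i; exact: grid_approx.
have /choice[enc henc] : forall i, exists j, dec j = (i, [ffun a => s (i, a)]).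
  by move=> i; exact: decP.
have encK : cancel enc (fun j => (dec j).1) by move=> i; rewrite henc.
exists (selector (fun j => (dec j).1) enc); first exact: sparse_selector.
rewrite sqnB (dot_quant w) sqn_quant//.
have -> : sqn b = \sum_i b (w i) 0 ^+ 2.
  by rewrite /sqn (reindex w)//; exact: onW_bij.
have /negP := nbad; rewrite -leNgt -/kappa; apply: le_trans.
rewrite -big_split mulr_sumr -sumrB /=; apply: ler_sum => i _.
rewrite (coef_selector _ encK (erefl : i.1 = i.1 :> nat)) henc ffunE.
by apply: le_trans (hs i); case: i => i a /=; rewrite sqrrB; lra.
Qed.

Lemma ambient_lower_bound (n' n3 d k m : nat) (eps p eta : R)
    (D : probability (borel_mx R m (n' + n3)) R) (E : estimator R m d) :
  (0 < n')%N -> (n' <= k)%N -> (k <= d)%N ->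
  0 < eps -> eps < 1 -> 0 < eta -> 8 * eta <= p - 2^-1 ->
  oblivious_linear_sketch k eps p D E ->
  (eta / 2) ^+ 2 / 8 * eta / 65 * n'%:R < m%:R.
Proof.
move=> n'0 n'k kd e0 e1 eta0 etap obl.
have n'd := leq_trans n'k kd.
apply: (@compressible_lower_bound R n' n3 d k m eps p eta D E
  (\matrix_(c, j) (widen_ord n'd c == j)%:R) set0) => //.
  by rewrite /gprob measure0; exact: ltW.
move=> b _; pose x : 'cV[R]_d := \col_j (if insub (val j) is Some c then b c 0 else 0).
exists x.
  rewrite /sparse /l0norm /=; apply: leq_trans n'k.
  rewrite -[leqRHS]card_ord; apply: leq_trans (leq_imset_card (widen_ord n'd) _).
  apply: subset_leq_card; apply/fintype.subsetP => j; rewrite inE mxE.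
  case: insubP => [c _ cj|]; last by rewrite eqxx.
  by move=> _; apply/imsetP; exists c => //; exact: val_inj.
rewrite (_ : _ *m x - b = 0).
  by rewrite sqn0 mulr_ge0 ?ler0n// divr_ge0// sqr_ge0.
apply/colP => c; rewrite !mxE (bigD1 (widen_ord n'd c))//= !mxE eqxx mul1r.
rewrite big1 ?addr0; last by move=> j jc; rewrite mxE eq_sym (negbTE jc) mul0r.
case: insubP => [c' _ /ord_inj ->|]; first exact: subrr.
by rewrite /= ltn_ord.
Qed.

End Grid.

(** * The three regimes of the parameters *)

Section Logarithm.
Context {R : realType}.

Lemma ln_ge1BV (x : R) : 0 < x -> 1 - x^-1 <= ln x.
Proof.
move=> x0; have := expR_ge1Dx (ln x^-1).
by rewrite lnK ?posrE ?invr_gt0// lnV ?posrE//; lra.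
Qed.

Lemma ln_leB1 (x : R) : 0 < x -> ln x <= x - 1.
Proof. by move=> x0; have := expR_ge1Dx (ln x); rewrite lnK ?posrE//; lra. Qed.

Lemma ln2_bounds : 2^-1 <= ln (2 : R) <= 1.
Proof.
by apply/andP; split; [have := @ln_ge1BV 2|have := @ln_leB1 2];
  move=> /(_ (ltr0Sn _ 1)); lra.
Qed.

Lemma trunc_log_ratio (b k d : nat) : (1 < b)%N -> (0 < k)%N -> (k <= d)%N ->
  let l := trunc_log b (d %/ k) in
  [/\ (k * b ^ l <= d)%N, l%:R * ln b%:R <= ln (d%:R / k%:R : R) &
      ln (d%:R / k%:R : R) <= l.+1%:R * ln b%:R].
Proof.
move=> b1 k0 kd l; have dk0 : (0 < d %/ k)%N by rewrite divn_gt0.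
have /andP[l1 l2] : (b ^ l <= d %/ k < b ^ l.+1)%N by exact: trunc_log_bounds.
have k0R : 0 < k%:R :> R by rewrite ltr0n.
have b0R : 0 < b%:R :> R by rewrite ltr0n (ltn_trans _ b1).
have d0R : 0 < d%:R :> R by rewrite ltr0n (leq_trans k0).
have lnX j : j%:R * ln b%:R = ln (b%:R ^+ j) :> R by rewrite lnXn// mulr_natl.
have kl : (k * b ^ l <= d)%N by rewrite mulnC -leq_divRL.
split => //; rewrite lnX ler_ln ?posrE ?divr_gt0 ?exprn_gt0//.
  by rewrite ler_pdivlMr// mulrC -natrX -natrM ler_nat.
rewrite ler_pdivrMr// mulrC -natrX -natrM ler_nat ltnW// mulnC.
by rewrite -ltn_divLR.
Qed.

Lemma truncn_half (y : R) : 1 <= y -> y / 2 <= (Num.truncn y)%:R.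
Proof.
move=> y1; have /andP[_ ] := truncn_itv (le_trans ler01 y1).
rewrite -natr1; have : 1 <= (Num.truncn y)%:R :> R.
  by rewrite ler1n truncn_gt0.
lra.
Qed.

(** For d >= 2k, every block carries sign vectors of length about log2(d/k). For k < d < 2k that
    length would be 0, but k ln(d/k) is comparable to d - k: the d - k extra columns then give that
    many blocks a second column, hence one sign each. *)
Lemma sign_blocks (k d : nat) : (0 < k)%N -> (k < d)%N ->
  exists k' L, [/\ (k' <= k)%N, (0 < k' * L)%N, (k' * 2 ^ L + (k - k') <= d)%N,
    k%:R * ln (d%:R / k%:R : R) <= 2 * (k' * L)%:R &
    (k' * L)%:R <= 2 * (k%:R * ln (d%:R / k%:R : R))].
Proof.
move=> k0 kd; have d0 := ltn_trans k0 kd.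
have k0R : 0 < k%:R :> R by rewrite ltr0n.
have d0R : 0 < d%:R :> R by rewrite ltr0n.
have dk0 : 0 < d%:R / k%:R :> R by rewrite divr_gt0.
set x : R := ln _; have /andP[l2 l2'] := ln2_bounds.
have [d2k|dk2] := leqP (2 * k) d.
  have [h1 h2 h3] := trunc_log_ratio (isT : (1 < 2)%N) k0 (ltnW kd).
  set L := trunc_log 2 (d %/ k) in h1 h2 h3; rewrite -/x in h2 h3.
  have L0 : (0 < L)%N.
    by rewrite trunc_log_gt0/= leq_divRL.
  exists k, L; split => //; first by rewrite muln_gt0 k0.
  - by rewrite subnn addn0.
  - rewrite natrM mulrCA ler_pM2l//; apply: (le_trans h3).
    have : L.+1%:R <= 2 * L%:R :> R by rewrite -natrM ler_nat mul2n -addnn -addn1 leq_add2l.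
    nra.
  - rewrite natrM mulrCA ler_pM2l//; have : 0 <= L%:R :> R by [].
    nra.
exists (d - k)%N, 1%N; rewrite muln1 expn1; split => //.
- by rewrite leq_subLR addnn -mul2n ltnW.
- by rewrite subn_gt0.
- lia.
- rewrite natrB; last exact: ltnW.
  have := ln_leB1 dk0; rewrite -/x -(ler_pM2l k0R) => /le_trans; apply.
  have -> : k%:R * (d%:R / k%:R - 1) = d%:R - k%:R :> R by field; rewrite gt_eqF.
  have : k%:R <= d%:R :> R by rewrite ler_nat ltnW.
  lra.
rewrite natrB; last exact: ltnW.
have := ln_ge1BV dk0; rewrite -/x invf_div => h.
have : d%:R * (1 - k%:R / d%:R) <= d%:R * x by rewrite ler_pM2l.
have -> : d%:R * (1 - k%:R / d%:R) = d%:R - k%:R :> R by field; rewrite gt_eqF.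
move=> /le_trans; apply; rewrite mulrA ler_wpM2r//.
  by rewrite ln_ge0// ler_pdivlMr// mul1r ler_nat ltnW.
by rewrite -natrM ler_nat ltnW.
Qed.

End Logarithm.

(** * Choice of dimensions in each regime *)

Section Regimes.
Context {R : realType}.

Lemma ambient_regime (n d k m : nat) (eps p eta T C : R)
    (D : probability (borel_mx R m n) R) (E : estimator R m d) :
  (0 < n)%N -> (0 < k)%N -> (k <= d)%N ->
  0 < eps -> eps < 1 -> 0 < eta -> 8 * eta <= p - 2^-1 ->
  1 <= C -> 0 <= T -> T <= n%:R -> T <= C * k%:R ->
  oblivious_linear_sketch k eps p D E ->
  (eta / 2) ^+ 2 / 8 * eta / 65 / (2 * C) * T <= m%:R.
Proof.
move=> n0 k0 kd e0 e1 eta0 etap C1 T0 Tn Tk obl.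
have C0 : 0 < C by lra.
pose y := T / C; have y0 : 0 <= y by rewrite divr_ge0// ltW.
have yt : (Num.truncn y)%:R <= y by rewrite truncn_le.
(* The maximum with 1 covers y < 1, where the truncation is 0 but a row is still required. *)
pose n' := maxn 1 (Num.truncn y).
have n'0 : (0 < n')%N by rewrite leq_max.
have n'k : (n' <= k)%N.
  rewrite geq_max k0 -(ler_nat R) (le_trans yt)//.
  by rewrite ler_pdivrMr// mulrC.
have n'n : (n' <= n)%N.
  rewrite geq_max n0 -(ler_nat R) (le_trans yt)//.
  by rewrite ler_pdivrMr// (le_trans Tn)// ler_peMr.
have yn' : y / 2 <= n'%:R.
  have [y1|y1] := leP 1 y.
    by rewrite (le_trans (truncn_half y1))// ler_nat leq_maxr.
  by apply: (@le_trans _ _ 1); [lra|rewrite ler1n].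
have En : n = (n' + (n - n'))%N by rewrite subnKC.
move: (n - n')%N En => n3 En; subst n.
have := ambient_lower_bound n'0 n'k kd e0 e1 eta0 etap obl.
move=> /ltW; apply: le_trans.
set cA := _ / 65; have cA0 : 0 <= cA.
  by rewrite /cA !(mulr_ge0, divr_ge0, sqr_ge0)// ltW.
have -> : cA / (2 * C) * T = cA * (y / 2) by rewrite /y; field; rewrite gt_eqF.
by rewrite ler_wpM2l.
Qed.

(** As eps^2 >= e2, T is at most k ln(d/k) / e2, while the k l Gaussian coordinates number at least
    k ln(d/k) / (2 ln g): rounding the logarithm down loses a factor of at most 2 once l > 0. *)
Lemma grid_regime (n d k m N : nat) (eps p eta T e2 : R)
    (D : probability (borel_mx R m n) R) (E : estimator R m d) :
  let g := (2 * N ^ 2).+1 in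
  (0 < k)%N -> (k <= d)%N ->
  0 < eps -> eps < 1 -> 0 < eta -> 8 * eta <= p - 2^-1 ->
  (1 < N)%N -> 64 * 65 <= eta ^+ 3 * N%:R ->
  T = k%:R * ln (d%:R / k%:R) / eps ^+ 2 -> T <= n%:R ->
  0 < e2 -> e2 <= eps ^+ 2 -> ln g%:R <= ln (d%:R / k%:R : R) ->
  oblivious_linear_sketch k eps p D E ->
  (eta / 2) ^+ 2 / 8 * eta / 65 * e2 / (2 * ln g%:R) * T <= m%:R.
Proof.
move=> g k0 kd e0 e1 eta0 etap N1 etaN TE Tn e20 e2eps gx obl.
have k0R : 0 < k%:R :> R by rewrite ltr0n.
have g1 : (1 < g)%N by rewrite /g ltnS muln_gt0 /= expn_gt0 (ltnW N1).
have [h1 h2 h3] := @trunc_log_ratio R g k d g1 k0 kd.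
set l := trunc_log g (d %/ k) in h1 h2 h3.
set x : R := ln (d%:R / k%:R) in TE gx h2 h3.
have /andP[l2 _] := @ln2_bounds R.
have lng : 1 <= ln g%:R :> R.
  apply: (@le_trans _ _ (ln (2 ^+ 2))); first by rewrite lnXn// mulr2n; lra.
  rewrite ler_ln ?posrE ?exprn_gt0 ?ltr0n// -natrX ler_nat /g.
  by rewrite (@leq_trans (2 * 2 ^ 2))// leqW// leq_mul2l /= leq_exp2r.
have lng0 : 0 < ln g%:R :> R by lra.
have l0 : (0 < l)%N.
  have d0R : 0 < d%:R :> R by rewrite ltr0n (leq_trans k0).
  move: gx; rewrite ler_ln ?posrE ?divr_gt0// ?ltr0n// ler_pdivlMr// -natrM.
  by rewrite ler_nat trunc_log_gt0 g1 /= leq_divRL.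
have kx : k%:R * x = T * eps ^+ 2 by rewrite TE divfK// gt_eqF// exprn_gt0.
have eps2 : eps ^+ 2 <= 1 by rewrite expr_le1// ltW.
have x0 : 0 <= x by rewrite (le_trans _ gx)// ltW.
have T0 : 0 <= T by rewrite TE divr_ge0 ?sqr_ge0// mulr_ge0// ler0n.
have kl_n : (k * l <= n)%N.
  rewrite -(ler_nat R) (le_trans _ Tn)// (@le_trans _ _ (k%:R * x))//.
    rewrite natrM ler_pM2l// (le_trans _ h2)// ler_peMr//.
  by rewrite kx ler_piMr.
have kl0 : (0 < k * l)%N by rewrite muln_gt0 k0.
have En : n = (k * l + (n - k * l))%N by rewrite subnKC.
move: (n - k * l)%N En => n3 En; subst n.
have := grid_lower_bound kl0 (ltnW N1) etaN h1 e0 e1 eta0 etap obl.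
move=> /ltW; apply: le_trans.
set cA := _ / 65; have cA0 : 0 <= cA.
  by rewrite /cA !(mulr_ge0, divr_ge0, sqr_ge0)// ltW.
have -> : cA * e2 / (2 * ln g%:R) * T = cA * (e2 * T / (2 * ln g%:R)).
  by field; rewrite gt_eqF.
rewrite ler_wpM2l// ler_pdivrMr ?mulr_gt0//.
apply: (@le_trans _ _ (k%:R * x)); first by rewrite kx mulrC ler_wpM2l.
rewrite natrM -mulrA ler_pM2l// (le_trans h3)//.
rewrite mulrA ler_pM2r// -natrM ler_nat muln2 -addnn -addn1 leq_add2l//.
Qed.

Lemma sign_regime (n d k m : nat) (eps p eta T c4 : R)
    (D : probability (borel_mx R m n) R) (E : estimator R m d) :
  (0 < k)%N -> (k < d)%N ->
  0 < eps -> eps < 1 -> 0 < eta -> 8 * eta <= p - 2^-1 ->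
  T = k%:R * ln (d%:R / k%:R) / eps ^+ 2 -> T <= n%:R ->
  0 < c4 -> c4 <= 1 -> (6 * (65 / eta) + 10) ^+ 2 * c4 <= (eta / 4) ^+ 2 ->
  eps ^+ 2 <= c4 / 4 -> 4 * k%:R <= T ->
  oblivious_linear_sketch k eps p D E ->
  (eta / 32) ^+ 2 * eta / 65 * (c4 / 4) * T <= m%:R.
Proof.
move=> k0 kd e0 e1 eta0 etap TE Tn c40 c41 hc4 heps kT obl.
have k0R : 0 < k%:R :> R by rewrite ltr0n.
have [k' [L [hk r0 hd r1 r2]]] := @sign_blocks R k d k0 kd.
set x : R := ln (d%:R / k%:R) in TE r1 r2.
have eps2 : 0 < eps ^+ 2 by rewrite exprn_gt0.
have kx : k%:R * x = T * eps ^+ 2 by rewrite TE divfK// gt_eqF.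
have T0 : 0 < T by apply: lt_le_trans kT; rewrite mulr_gt0.
(* The truncation of y is the length of the Gaussian vector. It is large enough for the window, r <=
   2 T eps^2 <= y, small enough for eps^2 y <= c4 r, and with the k forcing rows it fits: y + k <=
   T/2 + T/4 <= n. *)
pose y := c4 / 2 * T.
have ry : (k' * L)%:R <= y.
  apply: (le_trans r2); rewrite kx /y; nra.
have y1 : 1 <= y by apply: le_trans ry; rewrite ler1n.
have y0 : 0 <= y by lra.
have yh := truncn_half y1; have yt : (Num.truncn y)%:R <= y by rewrite truncn_le.
have hr : (k' * L <= Num.truncn y)%N by rewrite truncn_ge_nat.
have t0 : (0 < Num.truncn y)%N by rewrite (leq_trans r0).
case Et : (Num.truncn y) hr t0 yh yt => [//|N] hr _ yh yt.
have hN : (N.+1 + k <= n)%N.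
  rewrite -(ler_nat R) natrD (le_trans _ Tn)//.
  have : y <= T / 2 by rewrite /y; nra.
  lra.
have heps' : (6 * (65 / eta) + 10) ^+ 2 * (eps ^+ 2 * N.+1%:R) <=
    (eta / 4) ^+ 2 * (k' * L)%:R.
  apply: (@le_trans _ _ ((6 * (65 / eta) + 10) ^+ 2 * (c4 * (k' * L)%:R))).
    rewrite ler_wpM2l ?sqr_ge0// (@le_trans _ _ (eps ^+ 2 * y))//.
      by rewrite ler_pM2l.
    by rewrite /y; have -> : eps ^+ 2 * (c4 / 2 * T) = c4 / 2 * (k%:R * x);
      [rewrite kx; ring|nra].
  by rewrite (mulrA _ c4) ler_wpM2r// ler0n.
have En : n = (N.+1 + k + (n - (N.+1 + k)))%N by rewrite subnKC.
move: (n - (N.+1 + k))%N En => n3 En; subst n.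
have := window_lower_bound hk r0 hr hd e0 e1 eta0 etap heps' obl.
move=> /ltW; apply: le_trans.
set cB := _ / 65; have cB0 : 0 <= cB.
  by rewrite /cB !(mulr_ge0, divr_ge0, sqr_ge0)// ltW.
have -> : cB * (c4 / 4) * T = cB * (y / 2) by rewrite /y; field.
by rewrite ler_wpM2l.
Qed.

End Regimes.

Theorem theorem1 (R : realType) (p : R) (hp : 2^-1 < p) :
  exists2 c : R, 0 < c &
    forall (n d k : nat) (eps : R),
      (0 < n)%N -> (0 < d)%N -> (0 < k)%N -> (k <= d)%N ->
      0 < eps -> eps < 1 ->
      k%:R * ln (d%:R / k%:R) / eps ^+ 2 <= n%:R ->
      forall (m : nat) (D : probability (borel_mx R m n) R)
             (E : estimator R m d),
        oblivious_linear_sketch k eps p D E ->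
        c * (k%:R * ln (d%:R / k%:R) / eps ^+ 2) <= m%:R.
Proof.
pose eta : R := Num.min ((p - 2^-1) / 8) 1.
have eta0 : 0 < eta by rewrite lt_min ltr01 andbT; lra.
have eta1 : eta <= 1 by rewrite ge_min lexx orbT.
have etap : 8 * eta <= p - 2^-1.
  have : eta <= (p - 2^-1) / 8 by rewrite ge_min lexx.
  lra.
pose b : R := (6 * (65 / eta) + 10) ^+ 2.
have b1 : 1 <= b.
  have : 0 <= 65 / eta by rewrite divr_ge0// ltW.
  by rewrite /b => ?; nra.
have b0 : 0 < b by lra.
(* The largest value of eps^2 [N.+1] / r that [window_lower_bound] tolerates. *)
pose c4 : R := (eta / 4) ^+ 2 / b.
have c40 : 0 < c4 by rewrite divr_gt0// exprn_gt0// divr_gt0.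
have hc4 : b * c4 <= (eta / 4) ^+ 2 by rewrite /c4 mulrC divfK// gt_eqF.
have c41 : c4 <= 1.
  by rewrite ler_pdivrMr// mul1r (le_trans _ b1)// expr_le1//; lra.
pose N := maxn 2 (Num.truncn (64 * 65 / eta ^+ 3)).+1.
have N1 : (1 < N)%N by rewrite leq_max.
have etaN : 64 * 65 <= eta ^+ 3 * N%:R.
  rewrite [leRHS]mulrC -ler_pdivrMr ?exprn_gt0//.
  apply: (@le_trans _ _ (Num.truncn (64 * 65 / eta ^+ 3)).+1%:R).
    by apply: ltW; exact: truncnS_gt.
  by rewrite ler_nat leq_maxr.
pose g := (2 * N ^ 2).+1.
have lng : 0 < ln g%:R :> R.
  by rewrite ln_gt0// ltr1n /g ltnS muln_gt0 /= expn_gt0 (ltnW N1).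
(* The first summand gives 4k <= T in the sign regime. The second makes T > C k together with eps^2
   > c4/4 imply ln(d/k) >= ln g, so that the grid regime has blocks of positive length. Being
   positive, C also excludes d = k, where T = 0. *)
pose C : R := 4 + 4 * ln g%:R / c4.
have C40 : 0 <= 4 * ln g%:R / c4.
  by apply: divr_ge0; [apply: mulr_ge0 => //; exact: ltW|exact: ltW].
have C4 : 4 <= C by rewrite lerDl.
pose cA : R := (eta / 2) ^+ 2 / 8 * eta / 65 / (2 * C).
pose cG : R := (eta / 2) ^+ 2 / 8 * eta / 65 * (c4 / 4) / (2 * ln g%:R).
pose cS : R := (eta / 32) ^+ 2 * eta / 65 * (c4 / 4).
exists (Num.min cA (Num.min cG cS)).
  have C0 : 0 < C by apply: lt_le_trans C4.
  rewrite !lt_min /cA /cG /cS; apply/and3P; split;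
  by do ![assumption|apply: divr_gt0|apply: mulr_gt0|apply: exprn_gt0|done].
move=> n d k eps n0 d0 k0 kd e0 e1 hT m D E obl.
set T := _ / eps ^+ 2 in hT *.
have k0R : 0 < k%:R :> R by rewrite ltr0n.
have eps2 : 0 < eps ^+ 2 by rewrite exprn_gt0.
have x0 : 0 <= ln (d%:R / k%:R) :> R.
  by rewrite ln_ge0// ler_pdivlMr// mul1r ler_nat.
have T0 : 0 <= T by rewrite divr_ge0 ?sqr_ge0// mulr_ge0// ler0n.
have le_c c' : Num.min cA (Num.min cG cS) <= c' -> c' * T <= m%:R ->
    Num.min cA (Num.min cG cS) * T <= m%:R.
  by move=> cc; apply: le_trans; rewrite ler_wpM2r.
have [TC|CT] := leP T (C * k%:R).
  apply: (le_c cA); first by rewrite ge_min lexx.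
  apply: (ambient_regime n0 k0 kd e0 e1 eta0 etap _ T0 hT TC obl); lra.
have [heps|heps] := leP (eps ^+ 2) (c4 / 4).
  apply: (le_c cS); first by rewrite !ge_min lexx !orbT.
  have kd' : (k < d)%N.
    rewrite ltn_neqAle kd andbT; apply/eqP => kdE; move: CT.
    rewrite /T -kdE divff ?gt_eqF// ln1 mulr0 mul0r; nra.
  apply: (sign_regime k0 kd' e0 e1 eta0 etap erefl hT c40 c41 hc4 heps _ obl).
  by apply: le_trans (ltW CT); rewrite ler_pM2r.
apply: (le_c cG); first by rewrite !ge_min lexx !orbT.
apply: (grid_regime k0 kd e0 e1 eta0 etap N1 etaN erefl hT _ (ltW heps) _ obl).
  by rewrite divr_gt0.
have : C * k%:R * eps ^+ 2 < k%:R * ln (d%:R / k%:R) by rewrite -ltr_pdivlMr.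
rewrite -mulrA mulrCA ltr_pM2l// => /ltW; apply: le_trans.
have -> : ln g%:R = (4 * ln g%:R / c4) * (c4 / 4) :> R by field; rewrite gt_eqF.
apply: ler_pM => //; [exact/ltW/divr_gt0| |exact: ltW].
by rewrite /C lerDr.
Qed.
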